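(* Let $\kappa$ be any measure of concordance and let $P$ be a $d\times d$ hierarchical matrix with corresponding hierarchical tree whose nodes $v$ carry the numbers $\rho_v$. If $0\le\rho_v\le\rho_{v'}$ holds for every pair of nodes $(v,v')$ such that $v$ is a parent of $v'$, then $P$ is $\kappa$-compatible and $\kappa$-attainable (by a nested or hierarchical Archimedean copula).
   Context: Hierarchical matrix: consider a finite rooted tree whose leaves correspond to the sets of a partition of $\{1,\dots,d\}$ (groups of variable indices), with a number $\rho_v\in[-1,1]$ attached to each node $v$ (leaves included). If two nodes are adjacent, the one closer to the root is the parent of the other. For $i\in\{1,\dots,d\}$ let $v_i$ be the leaf whose group contains $i$. The matrix $P$ with $P_{ii}=1$ and, for $i\ne j$, $P_{ij}=\rho_{v}$ where $v$ is the lowest common ancestor of $v_i$ and $v_j$ (equal to $v_i$ itself if $v_i=v_j$; otherwise the node farthest from the root lying on both paths from $v_i$ and from $v_j$ to the root) is called a hierarchical matrix and the tree its hierarchical tree. Measure of concordance (Scarsini): a map $\kappa$ on pairs of continuously distributed random variables such that (1) $\kappa(X_1,X_2)$ is defined for all such pairs; (2) $\kappa(X_1,X_2)=\kappa(X_2,X_1)$; (3) if the copulas satisfy $C_1\le C_2$ pointwise then $\kappa(C_1)\le\kappa(C_2)$ (so $\kappa$ depends only on the copula); (4) $-1\le\kappa\le1$, with $\kappa=1$ for the comonotone copula $\min\{u_1,u_2\}$ and $\kappa=-1$ for the countermonotone copula $\max\{u_1+u_2-1,0\}$; (5) $\kappa=0$ under independence; (6) $\kappa(X_1,-X_2)=-\kappa(X_1,X_2)$;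 (7) if $(X_{n1},X_{n2})\sim H_n$, $(X_1,X_2)\sim H$ have continuous margins and $H_n\to H$ pointwise then $\kappa(X_{n1},X_{n2})\to\kappa(X_1,X_2)$. $P\in[-1,1]^{d\times d}$ is $\kappa$-compatible if there is a random vector $\boldsymbol X=(X_1,\dots,X_d)$ with continuous margins such that $P=(\kappa(X_i,X_j))_{i,j}$, and $\kappa$-attainable if such a random vector can be constructed. An Archimedean copula is $C(u_1,\dots,u_n)=\psi(\psi^{-1}(u_1)+\cdots+\psi^{-1}(u_n))$ with generator $\psi:[0,\infty]\to[0,1]$. A nested (hierarchical) Archimedean copula on a rooted tree is the copula obtained by attaching an Archimedean copula (the independence and comonotone copulas being allowed as limiting cases) to each node and, recursively from the leaves, inserting the copulas attached to the children of a node as arguments of the copula attached to the node, the copula at a leaf being evaluated at the variables $u_i$ of the leaf's group.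
   Formalization: The number at the root is also assumed nonnegative; this follows from the stated condition unless the tree has a single node, where the condition is vacuous and the claim fails (d=3, ρ=−1, Spearman's rho). *)

(* Defs.v *)
(* MathComp-Analysis; the reals are an arbitrary realType. *)
From HB Require Import structures.
From mathcomp Require Export all_boot all_order all_algebra.
From mathcomp Require Export all_classical all_reals all_analysis.
From mathcomp Require Export measurable_realfun.

#[export] Set Implicit Arguments.
#[export] Unset Strict Implicit.
#[export] Unset Printing Implicit Defensive.

Import Order.TTheory GRing.Theory Num.Theory.
Import numFieldNormedType.Exports.

Local Open Scope classical_set_scope.
Local Open Scope ring_scope.

Section Copulas.
Context {R : realType}.

Section RandomVectors.
Context {dp : measure_display} {O : measurableType dp} {Pr : probability O R}.

Definition joint_cdf n (X : 'I_n -> {RV Pr >-> R}) (x : 'I_n -> R) : \bar R :=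
  Pr [set w | forall i, X i w <= x i].

Definition rv_pair (X Y : {RV Pr >-> R}) : 'I_2 -> {RV Pr >-> R} :=
  fun i => if i == 0 then X else Y.

Definition continuous_margin (X : {RV Pr >-> R}) : Prop := continuous (cdf X).

Definition independent_rv (X Y : {RV Pr >-> R}) : Prop :=
  forall A B : set R, measurable A -> measurable B ->
    Pr (X @^-1` A `&` Y @^-1` B) = (Pr (X @^-1` A) * Pr (Y @^-1` B))%E.

End RandomVectors.

Definition unit_cube n (u : 'I_n -> R) : Prop := forall i, 0 <= u i <= 1.

(* A copula is a distribution function on [0, 1]^n with standard uniform
   margins; the values of C outside the unit cube are irrelevant. *)
Definition is_copula n (C : ('I_n -> R) -> R) : Prop :=
  exists (dp : measure_display) (O : measurableType dp) (Pr : probability O R)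
    (U : 'I_n -> {RV Pr >-> R}),
    (forall i t, 0 <= t <= 1 -> cdf (U i) t = t%:E) /\
    (forall u, unit_cube u -> joint_cdf U u = (C u)%:E).

(* Sklar's representation. For continuous margins C is unique on the cube. *)
Definition copula_of (dp : measure_display) (O : measurableType dp)
    (Pr : probability O R) n (X : 'I_n -> {RV Pr >-> R})
    (C : ('I_n -> R) -> R) : Prop :=
  is_copula C /\
  forall x, joint_cdf X x = (C (fun i => fine (cdf (X i) (x i))))%:E.

Definition independence_copula n (u : 'I_n -> R) : R := \prod_i u i.

Definition comonotone_copula n (u : 'I_n -> R) : R := \big[Num.min/1]_i u i.

Definition countermonotone_copula (u : 'I_2 -> R) : R :=
  Num.max (u 0 + u 1 - 1) 0.

Definition concordance_map : Type :=
  forall (dp : measure_display) (O : measurableType dp) (Pr : probability O R),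
    {RV Pr >-> R} -> {RV Pr >-> R} -> R.

(* Only the values of kappa on pairs with continuous margins are constrained
   or used; being defined for all such pairs is the totality of kappa. *)
Record measure_of_concordance (kappa : concordance_map) : Prop := {
  moc_sym : forall (dp : measure_display) (O : measurableType dp)
      (Pr : probability O R) (X Y : {RV Pr >-> R}),
    continuous_margin X -> continuous_margin Y ->
    kappa _ _ _ X Y = kappa _ _ _ Y X;
  moc_mono : forall (dp dp' : measure_display)
      (O : measurableType dp) (O' : measurableType dp')
      (Pr : probability O R) (Pr' : probability O' R)
      (X Y : {RV Pr >-> R}) (X' Y' : {RV Pr' >-> R}) (C C' : ('I_2 -> R) -> R),
    continuous_margin X -> continuous_margin Y ->
    continuous_margin X' -> continuous_margin Y' ->
    copula_of (rv_pair X Y) C -> copula_of (rv_pair X' Y') C' ->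
    (forall u, unit_cube u -> C u <= C' u) ->
    kappa _ _ _ X Y <= kappa _ _ _ X' Y';
  moc_itv : forall (dp : measure_display) (O : measurableType dp)
      (Pr : probability O R) (X Y : {RV Pr >-> R}),
    continuous_margin X -> continuous_margin Y ->
    -1 <= kappa _ _ _ X Y <= 1;
  moc_comonotone : forall (dp : measure_display) (O : measurableType dp)
      (Pr : probability O R) (X Y : {RV Pr >-> R}),
    continuous_margin X -> continuous_margin Y ->
    copula_of (rv_pair X Y) (@comonotone_copula 2) ->
    kappa _ _ _ X Y = 1;
  moc_countermonotone : forall (dp : measure_display) (O : measurableType dp)
      (Pr : probability O R) (X Y : {RV Pr >-> R}),
    continuous_margin X -> continuous_margin Y ->
    copula_of (rv_pair X Y) countermonotone_copula ->
    kappa _ _ _ X Y = -1;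
  moc_independent : forall (dp : measure_display) (O : measurableType dp)
      (Pr : probability O R) (X Y : {RV Pr >-> R}),
    continuous_margin X -> continuous_margin Y ->
    independent_rv X Y ->
    kappa _ _ _ X Y = 0;
  moc_opp : forall (dp : measure_display) (O : measurableType dp)
      (Pr : probability O R) (X Y : {RV Pr >-> R}),
    continuous_margin X -> continuous_margin Y ->
    kappa _ _ Pr X (- Y) = - kappa _ _ Pr X Y;
  moc_continuous : forall (dpn : nat -> measure_display)
      (On : forall k, measurableType (dpn k))
      (Prn : forall k, probability (On k) R)
      (Xn Yn : forall k, {RV (Prn k) >-> R})
      (dp : measure_display) (O : measurableType dp) (Pr : probability O R)
      (X Y : {RV Pr >-> R}),
    (forall k, continuous_margin (Xn k)) ->
    (forall k, continuous_margin (Yn k)) ->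
    continuous_margin X -> continuous_margin Y ->
    (forall x, joint_cdf (rv_pair (Xn k) (Yn k)) x @[k --> \oo] -->
               joint_cdf (rv_pair X Y) x) ->
    kappa _ _ _ (Xn k) (Yn k) @[k --> \oo] --> kappa _ _ _ X Y }.

Definition kappa_compatible (kappa : concordance_map) d (P : 'M[R]_d) : Prop :=
  exists (dp : measure_display) (O : measurableType dp) (Pr : probability O R)
    (X : 'I_d -> {RV Pr >-> R}),
    (forall i, continuous_margin (X i)) /\
    P = \matrix_(i, j) kappa _ _ _ (X i) (X j).

Definition kappa_attainable_by (kappa : concordance_map) d (P : 'M[R]_d)
    (C : ('I_d -> R) -> R) : Prop :=
  exists (dp : measure_display) (O : measurableType dp) (Pr : probability O R)
    (X : 'I_d -> {RV Pr >-> R}),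
    [/\ forall i, continuous_margin (X i),
        copula_of X C &
        P = \matrix_(i, j) kappa _ _ _ (X i) (X j)].

Record archimedean_generator (psi : \bar R -> R) : Prop := {
  generator0 : psi 0%E = 1;
  generatory : psi +oo%E = 0;
  generator_cvgy : psi t%:E @[t --> +oo] --> psi +oo%E;
  generator_continuous :
    {within `[0, +oo[%classic, continuous (fun t : R => psi t%:E)};
  generator_noninc :
    forall s t : \bar R, (0 <= s)%E -> (s <= t)%E -> psi t <= psi s;
  generator_decr : forall s t : \bar R, (0 <= s)%E -> (s < t)%E ->
    (t <= ereal_inf [set x : \bar R | (0 <= x)%E /\ psi x = 0%R])%E ->
    psi t < psi s }.

(* On (0, 1] this is the inverse of psi; at 0 it is inf {t | psi t = 0}. *)
Definition generator_inv (psi : \bar R -> R) (x : R) : \bar R :=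
  ereal_inf [set t : \bar R | (0 <= t)%E /\ psi t = x].

Definition archimedean n (psi : \bar R -> R) (u : 'I_n -> R) : R :=
  psi (\sum_i generator_inv psi (u i))%E.

(* psi is not assumed n-monotone: that its formula defines a copula in
   dimension n is what is_copula requires. *)
Definition archimedean_copula n (C : ('I_n -> R) -> R) : Prop :=
  is_copula C /\
  [\/ exists2 psi, archimedean_generator psi &
        forall u, unit_cube u -> C u = archimedean psi u,
      forall u, unit_cube u -> C u = independence_copula u |
      forall u, unit_cube u -> C u = comonotone_copula u].

End Copulas.

Arguments concordance_map : clear implicits.

(* By convention the root is its own parent, so that the path from v to the
   root is the orbit of v under parent. *)
Record rooted_tree := RootedTree {
  node :> finType;
  root : node;
  parent : node -> node;
  parent_root : parent root = root;
  connected_root : forall v, fconnect parent v root }.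

Section Trees.
Variable T : rooted_tree.
Implicit Types v w : T.

Definition is_parent v w : bool := (w != root T) && (parent w == v).

Definition children v : {set T} := [set w | is_parent v w].

Definition leaf v : bool := children v == finset.set0.

Definition depth v : nat := findex (@parent T) v (root T).

Definition on_root_path v w : bool := fconnect (@parent T) v w.

Definition lca v w : T :=
  [arg max_(x > root T | on_root_path v x && on_root_path w x) depth x]%N.

End Trees.

(* The groups are the fibres of leaf_of; as every leaf is attained, they form
   a partition of 'I_d (into nonempty sets) in bijection with the leaves. *)
Record hierarchical_tree (R : realType) (d : nat) := HierarchicalTree {
  tree :> rooted_tree;
  leaf_of : 'I_d -> tree;
  leaf_ofP : forall v : tree, (v \in codom leaf_of) = leaf v;
  rho : tree -> R;
  rho_itv : forall v, -1 <= rho v <= 1 }.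

Definition group (R : realType) d (T : hierarchical_tree R d) (v : T) :
  {set 'I_d} := [set i | leaf_of T i == v].

Definition hierarchical_matrix (R : realType) d (T : hierarchical_tree R d) :
    'M[R]_d :=
  \matrix_(i, j) if i == j then 1 else rho (lca (leaf_of T i) (leaf_of T j)).

(* F v is the copula expression built on the subtree rooted at v. *)
Definition nested_archimedean_copula (R : realType) d
    (T : hierarchical_tree R d) (C : ('I_d -> R) -> R) : Prop :=
  is_copula C /\
  exists F : T -> ('I_d -> R) -> R,
    [/\ forall v, leaf v ->
          exists2 D : ('I_#|group v| -> R) -> R, archimedean_copula D &
            forall u, F v u = D (fun k => u (enum_val k)),
        forall v, ~~ leaf v ->
          exists2 D : ('I_#|children v| -> R) -> R, archimedean_copula D &
            forall u, F v u = D (fun k => F (enum_val k) u) &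
        C = F (root T)].

(* Main.v *)
From HB Require Import structures.
Require Import Defs.
From mathcomp Require Import ring lra zify.
Import Order.TTheory GRing.Theory Num.Theory.
Import numFieldNormedType.Exports.
Local Open Scope classical_set_scope.
Local Open Scope ring_scope.

(** The matrix is realised by a nested Joe copula. Write g_a(x) = 1 - (1 - x)^a
    (called [sib a] below). The Joe copula with parameter a in (0, 1] is C_a(u)
    = g_a (prod_i g_(1/a) (u_i)), with Archimedean generator t |-> g_a (exp (-
    t)); it is the independence copula for a = 1 and tends to the comonotone
    copula, taken as C_0, when a tends to 0.

    Choice of the parameters. By continuity of kappa under convergence of
    distribution functions, K(a) = kappa(C_a) is continuous on [0, 1], with
    K(0) = 1 and K(1) = 0. For r in [0, 1], alpha(r) = sup {a | r <= K(a)} thus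
    satisfies K(alpha(r)) = r, and alpha is nonincreasing by its very
    definition, whether or not K is monotone ([joe_parameter]). The node v
    receives the parameter a_v = alpha(rho_v), so that the parameters decrease
    from the root to the leaves.

    The nested expression is a copula. For 0 < a <= 1 the power series of g_a
    has nonnegative coefficients p_k, k >= 1, of sum 1. Hence if F is the
    distribution function of a random vector, so is g_a o F = sum_k p_k F^k: it
    is that of the coordinatewise maximum of N independent copies, N being
    drawn with probabilities p_k ([cube_cdf_sib]). Products of distribution
    functions are distribution functions too, for the same reason. Now g_(1/b)
    o g_a = g_(a/b), so if F_v denotes the expression built on the subtree of v
    and a_v > 0, then g_(1/b) o F_v = g_(a_v/b) (prod_c g_(1/a_v) o F_c), c
    running over the children of v. By induction from the leaves, g_(1/b) o F_v
    is a distribution function whenever a_v <= b <= 1 ([joe_nestable_joe]). A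
    node with a_v = 0 only has descendants of parameter 0, so that F_v is the
    minimum of the variables below v, and g_(1/b) o F_v is the distribution
    function of a comonotone vector.

    Bivariate margins. Setting all variables but u_i and u_j to 1 turns F_root
    into C_a(u_i, u_j), a being the parameter of the lowest common ancestor of
    the leaves of i and j ([nested_joe_pair]). As kappa depends only on the
    copula, the entry (i, j) of the concordance matrix is K(a) = rho at that
    ancestor, and the diagonal entries are K(0) = 1. *)

(** * Distribution functions on the unit cube *)

Section DistributionFunctions.
Context {R : realType} (n : nat).
Implicit Types (F G : ('I_n -> R) -> R) (u : 'I_n -> R).

(** F coincides on the unit cube with the distribution function of some law on
    R^n; the margins are arbitrary. *)
Definition cube_cdf F : Prop :=
  exists P : probability (n.-tuple R) R, forall u, unit_cube u ->
    P [set w | forall i, tnth w i <= u i] = (F u)%:E.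

Lemma measurable_le (d : measure_display) (O : measurableType d)
    (X : 'I_n -> O -> R) u :
  (forall i, measurable_fun setT (X i)) ->
  measurable [set w | forall i, X i w <= u i].
Proof.
move=> mX.
rewrite (_ : [set _ | _] = \bigcap_(i in [set: 'I_n]) (X i @^-1` `]-oo, u i])).
  apply: fin_bigcap_measurable => // i _.
  by rewrite -[X in measurable X]setTI; apply: mX.
apply/seteqP; split=> w /=.
  by move=> H i _ /=; rewrite in_itv /= H.
by move=> H i; move: (H i I) => /=; rewrite in_itv.
Qed.

Lemma measurable_orthant u :
  measurable [set w : n.-tuple R | forall i, tnth w i <= u i].
Proof.
apply: (@measurable_le _ _ (fun i w => tnth w i)) => i.
exact: measurable_tnth.
Qed.

Lemma cube_cdfE (dp : measure_display) (O : measurableType dp)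
    (P : probability O R) (X : 'I_n -> O -> R) F :
  (forall i, measurable_fun setT (X i)) ->
  (forall u, unit_cube u -> P [set w | forall i, X i w <= u i] = (F u)%:E) ->
  cube_cdf F.
Proof.
move=> mX PF.
pose f (w : O) : n.-tuple R := [tuple X i w | i < n].
have mf : measurable_fun setT f.
  apply/measurable_fun_tnthP => i.
  rewrite (_ : _ \o _ = X i) //; apply/funext => w /=.
  by rewrite tnth_mktuple.
pose f' : {mfun O >-> n.-tuple R} :=
  HB.pack f (isMeasurableFun.Build _ _ _ _ f mf).
exists (distribution P f') => u cu.
rewrite -PF //; congr (P _); apply/seteqP; split=> w /= H i.
  by move: (H i); rewrite tnth_mktuple.
by rewrite tnth_mktuple.
Qed.

Lemma cube_cdf_ext F G :
  (forall u, unit_cube u -> F u = G u) -> cube_cdf F -> cube_cdf G.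
Proof. by move=> FG [P PF]; exists P => u cu; rewrite PF // FG. Qed.

Lemma cube_cdf_itv F u : cube_cdf F -> unit_cube u -> 0 <= F u <= 1.
Proof.
move=> [P PF] cu; rewrite -!lee_fin -PF // measure_ge0 /=.
by apply: probability_le1; exact: measurable_orthant.
Qed.

Lemma cube_cdf1 : cube_cdf (fun=> 1).
Proof.
exists (dirac ([tuple 0 | i < n] : n.-tuple R)) => u cu.
rewrite /= diracE mem_set //= => i.
by rewrite tnth_mktuple; case/andP: (cu i).
Qed.

(** The coordinatewise maximum of two independent random vectors has the
    product of their distribution functions as distribution function. *)
Lemma cube_cdfM F G : cube_cdf F -> cube_cdf G -> cube_cdf (fun u => F u * G u).
Proof.
move=> [P PF] [Q QG].
apply: (@cube_cdfE _ _ (P \x Q)%E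
  (fun i (w : n.-tuple R * n.-tuple R) => Num.max (tnth w.1 i) (tnth w.2 i))).
  move=> i; apply: measurable_maxr.
    by apply: (measurableT_comp (measurable_tnth i)).
  by apply: (measurableT_comp (measurable_tnth i)).
move=> u cu; rewrite EFinM -PF // -QG //.
rewrite -product_measure1E; [|exact: measurable_orthant..].
congr ((P \x Q)%E _); apply/seteqP; split=> -[w w'] /=.
  by move=> H; split=> i; move: (H i); rewrite ge_max => /andP[].
by move=> [H H'] i; rewrite ge_max H H'.
Qed.

Lemma cube_cdf_prod (I : Type) (r : seq I) (p : pred I)
    (F : I -> ('I_n -> R) -> R) :
  (forall i, p i -> cube_cdf (F i)) ->
  cube_cdf (fun u => \prod_(i <- r | p i) F i u).
Proof.
move=> HF; elim: r => [|i r IH].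
  by apply: cube_cdf_ext cube_cdf1 => u _; rewrite big_nil.
case: (boolP (p i)) => pi.
  by apply: cube_cdf_ext (cube_cdfM (HF i pi) IH) => u _; rewrite big_cons pi.
by apply: cube_cdf_ext IH => u _; rewrite big_cons (negbTE pi).
Qed.

Lemma cube_cdfX F k : cube_cdf F -> cube_cdf (fun u => F u ^+ k).
Proof.
move=> HF; elim: k => [|k IH].
  by apply: cube_cdf_ext cube_cdf1 => u _; rewrite expr0.
by apply: cube_cdf_ext (cube_cdfM HF IH) => u _; rewrite exprS.
Qed.

(** A mixture of laws has the mixture of the distribution functions. *)
Lemma cube_cdf_mixture (p : nat -> R) (F : nat -> ('I_n -> R) -> R) G :
  (forall k, 0 <= p k) -> series p @ \oo --> (1 : R) ->
  (forall k, cube_cdf (F k)) ->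
  (forall u, unit_cube u -> [series p k * F k u]_k @ \oo --> G u) ->
  cube_cdf G.
Proof.
move=> p0 p1 /choice[P PF] pFG.
pose m (k : nat) : {measure set (n.-tuple R) -> \bar R} :=
  mscale (NngNum (p0 k)) (P k).
have mE A : measurable A -> forall g : nat -> R, (forall k, P k A = (g k)%:E) ->
    forall l, [series p k * g k]_k @ \oo --> l -> mseries m 0 A = l%:E.
  move=> mA g gE l gl; rewrite /mseries; apply/cvg_lim => //.
  rewrite (_ : (fun _ => _) = EFin \o [series p k * g k]_k).
    by apply/fine_cvgP; split=> //; near=> x.
  apply/funext => N /=; rewrite /series /= -sumEFin; apply: eq_bigr => k _.
  by rewrite /m /mscale /= gE EFinM.
have mT : mseries m 0 [set: n.-tuple R] = 1%E.
  apply: (mE _ _ (fun=> 1)) => // [k|]; first by rewrite probability_setT.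
  by under eq_fun do rewrite mulr1.
pose Q : probability (n.-tuple R) R :=
  HB.pack (mseries m 0) (Measure_isProbability.Build _ _ _ (mseries m 0) mT).
exists Q => u cu; apply: (mE _ _ (fun k => F k u)) => [|k|].
- exact: measurable_orthant.
- exact: PF.
- exact: pFG.
Unshelve. all: by end_near. Qed.

End DistributionFunctions.

Section Uniform.
Context {R : realType}.

Definition uniform01 := uniform_prob (@ltr01 R) : probability _ R.

Lemma uniform01E (A : set R) (s : R) : 0 <= s <= 1 ->
  A `&` `[0, 1]%classic = `[0, s]%classic ->
  uniform01 A = s%:E.
Proof.
move=> /andP[s0 s1] As.
rewrite /uniform01 /= /uniform_prob integral_uniform_pdf As.
rewrite (eq_integral (fun=> 1%E)); last first.
  move=> x; rewrite inE /= in_itv /= => /andP[x0 xs].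
  by rewrite /uniform_pdf x0 (le_trans xs s1) /= subr0 invr1.
rewrite integral_cst //= mul1e lebesgue_measure_itv /= lte_fin.
have [s0'|] := ltrP 0 s; first by rewrite oppr0 adde0.
by move=> s0'; have -> : s = 0 by apply/eqP; rewrite eq_le s0 s0'.
Qed.

(** On the cube, F is the minimum of the variables u_i with i in S (and of 1).
    *)
Definition comonotone_on n (S : pred 'I_n) (F : ('I_n -> R) -> R) : Prop :=
  forall u, unit_cube u -> 0 <= F u <= 1 /\
    forall s, 0 <= s <= 1 -> (s <= F u) = [forall i, S i ==> (s <= u i)].

(** If h and g form a Galois connection on [0, 1], h of a uniform variable has
    distribution function g. *)
Lemma cube_cdf_comonotone n (S : pred 'I_n) F (h g : R -> R) :
  measurable_fun setT h ->
  (forall s, 0 <= s <= 1 -> 0 <= h s <= 1) ->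
  (forall s, 0 <= s <= 1 -> 0 <= g s <= 1) ->
  (forall s t, 0 <= s <= 1 -> 0 <= t <= 1 -> (h s <= t) = (s <= g t)) ->
  comonotone_on S F -> cube_cdf (g \o F).
Proof.
move=> mh h01 g01 hg SF.
apply: (@cube_cdfE _ _ _ _ uniform01 (fun i w => if S i then h w else 0)).
  by move=> i; case: (S i).
move=> u cu; have [F01 FE] := SF u cu.
apply: uniform01E => /=; first exact: g01.
apply/seteqP; split=> w /=; rewrite !in_itv /=.
  move=> [H] w01; case/andP: (w01) => -> w1 /=.
  rewrite -hg // FE; last exact: h01.
  by apply/forallP => i; apply/implyP => Si; move: (H i); rewrite Si.
move=> /andP[w0 wg]; have w1 : w <= 1.
  by apply: (le_trans wg); case/andP: (g01 _ F01).
have w01 : 0 <= w <= 1 by rewrite w0.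
split=> // i; case: ifP => Si; last by case/andP: (cu i).
move: wg; rewrite -hg // FE; last exact: h01.
by move=> /forallP /(_ i); rewrite Si.
Qed.

End Uniform.

(** * The functions 1 - (1 - x)^a *)

Section Sibuya.
Context {R : realType}.
Implicit Types (a b x s t : R) (k n : nat).

(** For 0 < a <= 1, the generating function of the Sibuya distribution *)
Definition sib a x : R := 1 - (1 - x) `^ a.

Lemma sib_itv a x : 0 <= a -> 0 <= x <= 1 -> 0 <= sib a x <= 1.
Proof.
move=> a0 /andP[x0 x1]; rewrite /sib subr_ge0 gerBl powR_ge0 andbT.
suff : (1 - x) `^ a <= 1 `^ a by rewrite powR1.
by rewrite ge0_ler_powR ?nnegrE ?subr_ge0 ?gerBl.
Qed.

Lemma sib0 a : sib a 0 = 0.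
Proof. by rewrite /sib subr0 powR1 subrr. Qed.

Lemma sib1 a : a != 0 -> sib a 1 = 1.
Proof. by move=> a0; rewrite /sib subrr powR0 // subr0. Qed.

Lemma sib1l x : x <= 1 -> sib 1 x = x.
Proof. by move=> x1; rewrite /sib powRr1 ?subr_ge0 //; ring. Qed.

Lemma sib_comp a b x : sib a (sib b x) = sib (b * a) x.
Proof. by rewrite /sib powRrM; congr (1 - _ `^ _); ring. Qed.

Lemma sib_le a s t : 0 <= a -> s <= 1 -> t <= 1 -> s <= t -> sib a s <= sib a t.
Proof.
move=> a0 s1 t1 st; rewrite /sib lerD2l lerN2 ge0_ler_powR ?nnegrE ?subr_ge0 //.
by rewrite lerD2l lerN2.
Qed.

Lemma sibK a x : a != 0 -> x <= 1 -> sib a (sib a^-1 x) = x.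
Proof. by move=> a0 x1; rewrite sib_comp mulVf // sib1l. Qed.

Lemma sib_galois a s t : 0 < a -> 0 <= s <= 1 -> 0 <= t <= 1 ->
  (sib a s <= t) = (s <= sib a^-1 t).
Proof.
move=> a0 /[dup] s01 /andP[_ s1] /[dup] t01 /andP[_ t1].
have a0' := gt_eqF a0; have ai0 : 0 < a^-1 by rewrite invr_gt0.
apply/idP/idP => H.
  rewrite -[s](@sibK a^-1) ?invrK ?invr_eq0 ?a0' //.
  apply: sib_le => //; first exact: ltW.
  by case/andP: (sib_itv (ltW a0) s01).
rewrite -[t](@sibK a) ?a0' //; apply: sib_le => //; first exact: ltW.
by case/andP: (sib_itv (ltW ai0) t01).
Qed.

Lemma measurable_sib a : measurable_fun setT (sib a).
Proof.
apply: measurable_funB => //.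
by apply: (measurableT_comp (measurable_powR a)); apply: measurable_funB.
Qed.

(** The probability that a Sibuya variable exceeds k *)
Definition sib_tail a k : R := \prod_(j < k) (1 - a / j.+1%:R).

(** The coefficient of x^(k+1) in the power series of [sib a] *)
Definition sib_coef a k : R := a * sib_tail a k / k.+1%:R.

Definition sib_poly a n : {poly R} := \sum_(k < n) sib_coef a k *: 'X^(k.+1).

Lemma sib_tail_itv a k : 0 <= a <= 1 -> 0 <= sib_tail a k <= 1.
Proof.
move=> /andP[a0 a1]; elim: k => [|k /andP[IH0 IH1]].
  by rewrite /sib_tail big_ord0 ler01 lexx.
have ak : 0 <= a / k.+1%:R <= 1.
  by rewrite divr_ge0 //= ler_pdivrMr ?ltr0n // mul1r (le_trans a1) // ler1n.
move: ak; set b := a / _ => /andP[b0 b1].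
rewrite /sib_tail big_ord_recr /= -/(sib_tail a k).
by rewrite mulr_ge0 ?mulr_ile1 ?subr_ge0 // gerBl.
Qed.

Lemma sib_coef_ge0 a k : 0 <= a <= 1 -> 0 <= sib_coef a k.
Proof.
move=> /[dup] a01 /andP[a0 a1].
by rewrite divr_ge0 // mulr_ge0 //; case/andP: (sib_tail_itv k a01).
Qed.

Lemma horner_sib_poly a n x :
  (sib_poly a n).[x] = \sum_(0 <= k < n) sib_coef a k * x ^+ k.+1.
Proof.
rewrite /sib_poly horner_sum big_mkord; apply: eq_bigr => k _.
by rewrite !hornerE.
Qed.

(** The differential equation [(1 - x) y' = a (1 - y)] of [sib a], up to the
    truncation error. *)
Lemma sib_poly_ode a n x :
  (1 - x) * (sib_poly a n)^`().[x] =
  a * (1 - (sib_poly a n).[x]) - a * sib_tail a n * x ^+ n.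
Proof.
elim: n => [|n IH].
  by rewrite /sib_poly big_ord0 deriv0 /sib_tail big_ord0 !hornerE; ring.
rewrite /sib_poly big_ord_recr /= -/(sib_poly a n) derivD !hornerD mulrDr IH.
rewrite derivZ derivXn !hornerE /= hornerMn hornerXn.
rewrite /sib_tail big_ord_recr /= -/(sib_tail a n) /sib_coef -mulr_natr exprS.
by field; rewrite addrC natr1 pnatr_eq0.
Qed.

(** (1 - S_n (1 - y)) y^(-a), with S_n the n-th partial sum, is 1 at y = 1, and
    by the previous equation its derivative is - y^(-a-1) times the truncation
    error; the mean value theorem bounds its distance to 1. *)
Lemma sib_poly_bounds a n (y : R) : 0 < a <= 1 -> 0 < y <= 1 ->
  0 <= 1 - (sib_poly a n).[1 - y] - y `^ a <= (1 - y) ^+ n / y.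
Proof.
move=> /andP[a0 a1] /andP[y0]; rewrite le_eqVlt => /orP[/eqP->|y1].
  rewrite subrr horner_sib_poly big1 => [|k _]; last by rewrite expr0n mulr0.
  by rewrite powR1 divr1 subr0 subrr lexx exprn_ge0.
pose G := (1 - sib_poly a n) \Po (1 - 'X).
have GE z : G.[z] = 1 - (sib_poly a n).[1 - z].
  by rewrite /G horner_comp !hornerE.
pose H z := G.[z] * z `^ (- a).
pose dH z := - (a * sib_tail a n * (1 - z) ^+ n * z `^ (- a - 1)).
have dHP (z : R) : 0 < z -> is_derive z 1 H (dH z).
  move=> z0.
  have dG : is_derive z 1 (horner G) G^`().[z] by exact: is_derive_poly.
  have dP := is_derive1_powR (- a) z0.
  have := is_deriveM dG dP; rewrite /= /H => dM.
  apply: (@is_derive_eq _ _ _ _ _ _ _ _ dM).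
  rewrite /dH /GRing.scale /=.
  have -> : z `^ (- a) = z * z `^ (- a - 1).
    have := @powRD R z 1 (- a - 1); rewrite (lt0r_neq0 z0) implybT => /(_ isT).
    by rewrite powRr1 ?(ltW z0) // => <-; congr (_ `^ _); ring.
  have := sib_poly_ode a n (1 - z); rewrite -GE.
  have -> : (sib_poly a n)^`().[1 - z] = G^`().[z].
    by rewrite /G deriv_comp !poly.derivE !hornerE horner_comp !hornerE; ring.
  move=> ode.
  transitivity ((z * G^`().[z] - a * G.[z]) * z `^ (- a - 1)); first ring.
  rewrite (_ : z * G^`().[z] = (1 - (1 - z)) * G^`().[z]); last ring.
  by rewrite ode; ring.
have [||c cab E] := @MVT R H dH y 1 y1.
- by move=> x /andP[yx _]; apply: dHP; apply: lt_trans yx.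
- apply: derivable_within_continuous => x; rewrite in_itv /= => /andP[yx _].
  have := dHP x (lt_le_trans y0 yx); by case.
move: cab; rewrite in_itv /= => /andP[yc c1].
have H1 : H 1 = 1.
  rewrite /H GE subrr powR1 mulr1 horner_sib_poly big1 ?subr0 // => k _.
  by rewrite exprS mul0r mulr0.
have c0 : 0 < c by apply: lt_trans yc.
have yaK : y `^ (- a) * y `^ a = 1 by rewrite powRN mulVf // gt_eqF // powR_gt0.
have GyE : G.[y] = H y * y `^ a by rewrite /H -mulrA yaK mulr1.
have /andP[t0 t1] := @sib_tail_itv a n (introT andP (conj (ltW a0) a1)).
have {E} E :
    H y = 1 + a * sib_tail a n * (1 - c) ^+ n * c `^ (- a - 1) * (1 - y).
  have -> : H y = 1 - (1 - H y) by ring.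
  by rewrite -{2}H1 E /dH; ring.
rewrite -GE GyE E mulrDl mul1r addrAC subrr add0r.
have c1' : 0 <= 1 - c by rewrite subr_ge0 ltW.
have y1' : 0 <= 1 - y by rewrite subr_ge0 ltW.
apply/andP; split; first by rewrite !mulr_ge0 ?powR_ge0 ?exprn_ge0 // ltW.
have cy : c `^ (- a - 1) * y `^ a <= y^-1.
  rewrite powRD ?(lt0r_neq0 c0) ?implybT // powR_inv1 ?(ltW c0) //.
  rewrite mulrAC -[leRHS]mul1r.
  rewrite ler_pM ?mulr_ge0 ?powR_ge0 ?invr_ge0 ?(ltW c0) //.
    rewrite powRN mulrC ler_pdivrMr ?powR_gt0 // mul1r.
    by rewrite ge0_ler_powR ?nnegrE //; exact: ltW.
  by rewrite lef_pV2 ?posrE // ltW.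
have -> : a * sib_tail a n * (1 - c) ^+ n * c `^ (- a - 1) * (1 - y) * y `^ a =
  (a * sib_tail a n * (1 - y)) * ((1 - c) ^+ n * (c `^ (- a - 1) * y `^ a)).
  by ring.
rewrite -[leRHS]mul1r ler_pM ?mulr_ge0 ?powR_ge0 ?exprn_ge0 // ?(ltW a0) //.
  by rewrite !mulr_ile1 ?mulr_ge0 // ?(ltW a0) //; lra.
rewrite ler_pM ?mulr_ge0 ?powR_ge0 ?exprn_ge0 //.
by rewrite lerXn2r ?nnegrE // lerD2l lerN2 ltW.
Qed.

Lemma sib_poly1_itv a n x : 0 < a <= 1 -> 0 <= x <= 1 ->
  (sib_poly a n).[x] <= (sib_poly a n).[1] <= 1.
Proof.
move=> /andP[a0 a1] /andP[x0 x1].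
have a01 : 0 <= a <= 1 by rewrite ltW.
apply/andP; split.
  rewrite !horner_sib_poly ler_sum // => k _.
  by rewrite ler_wpM2l ?sib_coef_ge0 // lerXn2r ?nnegrE.
have := sib_poly_ode a n 1; rewrite subrr mul0r expr1n mulr1 => /esym/eqP.
rewrite -mulrBr mulf_eq0 gt_eqF //= subr_eq0 => /eqP E.
by rewrite -subr_ge0 E; case/andP: (sib_tail_itv n a01).
Qed.

Lemma sib_poly_cvg a (x : R) : 0 < a <= 1 -> 0 <= x <= 1 ->
  (sib_poly a n).[x] @[n --> \oo] --> sib a x.
Proof.
move=> a01 /andP[x0].
have geo (y : R) : 0 < y <= 1 -> (1 - y) ^+ n / y @[n --> \oo] --> (0 : R).
  move=> /andP[y0 y1].
  have := @cvg_geometric R y^-1 (1 - y).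
  rewrite ger0_norm ?subr_ge0 // gtrBl => /(_ y0).
  by rewrite /geometric /=; under eq_fun do rewrite mulrC.
rewrite le_eqVlt => /orP[/eqP->|x1]; last first.
  have y01 : 0 < 1 - x <= 1 by rewrite subr_gt0 x1 gerBl.
  apply/cvgrPdist_le => e e0.
  have /cvgrPdist_le /(_ e e0) := geo _ y01; apply: filterS => n.
  rewrite sub0r normrN => H.
  have := sib_poly_bounds n a01 y01; move: H.
  rewrite (_ : 1 - (1 - x) = x); last ring.
  rewrite (_ : 1 - (sib_poly a n).[x] - (1 - x) `^ a =
    sib a x - (sib_poly a n).[x]); last by rewrite /sib; ring.
  move=> H /andP[lo hi]; rewrite ger0_norm //; apply: le_trans hi _.
  by apply: le_trans (ler_norm _) H.
(* At 1 the partial sums lie between 1 and their values at 1 - y; the choice of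
   y gives y^a = min (e / 2) 1. *)
have /andP[a0 a1] := a01.
apply/cvgrPdist_le => e e0; rewrite sib1 ?gt_eqF //.
pose r := Num.min (e / 2) 1; pose y := r `^ a^-1.
have r0 : 0 < r by rewrite lt_min ltr01 divr_gt0.
have y0 : 0 < y by rewrite powR_gt0.
have y1 : y <= 1.
  suff : r `^ a^-1 <= 1 `^ a^-1 by rewrite powR1.
  rewrite ge0_ler_powR ?nnegrE ?invr_ge0 ?(ltW a0) ?(ltW r0) //.
  by rewrite ge_min lexx orbT.
have yr : y `^ a = r by rewrite -powRrM mulVf ?gt_eqF // powRr1 // ltW.
have y01 : 0 < y <= 1 by rewrite y0.
have e20 : 0 < e / 2 by rewrite divr_gt0.
have /cvgrPdist_le /(_ _ e20) := geo _ y01; apply: filterS => n.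
rewrite sub0r normrN => /(le_trans (ler_norm _)) H.
have y01' : 0 <= 1 - y <= 1 by rewrite subr_ge0 y1 gerBl (ltW y0).
have /andP[H1 H2] := sib_poly1_itv n a01 y01'.
rewrite ger0_norm ?subr_ge0 //.
have /andP[_] := sib_poly_bounds n a01 y01; rewrite yr => H3.
have re : r <= e / 2 by rewrite ge_min lexx.
lra.
Qed.

(** [sib a \o F] is the distribution function of the coordinatewise maximum of a
    Sibuya number of independent vectors with distribution function F. *)
Lemma cube_cdf_sib n a (F : ('I_n -> R) -> R) :
  0 < a <= 1 -> cube_cdf F -> cube_cdf (fun u => sib a (F u)).
Proof.
move=> /[dup] a01 /andP[a0 a1] HF.
apply: (@cube_cdf_mixture _ _ (sib_coef a) (fun k u => F u ^+ k.+1)).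
- by move=> k; apply: sib_coef_ge0; rewrite ltW.
- have := @sib_poly_cvg a 1 a01; rewrite sib1 ?gt_eqF // ler01 lexx => /(_ isT).
  apply: cvg_trans; apply: near_eq_cvg; near=> m.
  by rewrite horner_sib_poly; apply: eq_bigr => k _; rewrite expr1n mulr1.
- by move=> k; exact: cube_cdfX.
- move=> u cu; have := sib_poly_cvg a01 (cube_cdf_itv HF cu).
  by apply: cvg_trans; apply: near_eq_cvg; near=> m; rewrite horner_sib_poly.
Unshelve. all: by end_near. Qed.

End Sibuya.

(** * Joe copulas *)

Section Joe.
Context {R : realType}.
Implicit Types (a b x y : R) (n : nat).

(** The Joe copula, with the comonotone copula as limit at a = 0. *)
Definition joe a n (u : 'I_n -> R) : R :=
  if a == 0 then comonotone_copula u else sib a (\prod_i sib a^-1 (u i)).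

Definition vec2 x y : 'I_2 -> R := fun i => if i == 0 then x else y.

Lemma prod_itv (I : finType) (F : I -> R) :
  (forall i, 0 <= F i <= 1) -> 0 <= \prod_i F i <= 1.
Proof.
move=> F01; rewrite prodr_ge0 /= => [|i _]; last by case/andP: (F01 i).
by apply: prodr_ile1 => i _.
Qed.

Lemma comonotone_itv n (u : 'I_n -> R) :
  unit_cube u -> 0 <= comonotone_copula u <= 1.
Proof.
move=> cu; apply/andP; split; last by rewrite bigmin_le_id.
by apply/bigmin_geP; split=> // i _; case/andP: (cu i).
Qed.

Lemma joe_itv a n (u : 'I_n -> R) :
  0 <= a -> unit_cube u -> 0 <= joe a u <= 1.
Proof.
move=> a0 cu; rewrite /joe; case: eqP => [_|_]; first exact: comonotone_itv.
by apply: sib_itv => //; apply: prod_itv => i; rewrite sib_itv ?invr_ge0.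
Qed.

Lemma joe_const1 a n (u : 'I_n -> R) : (forall i, u i = 1) -> joe a u = 1.
Proof.
move=> u1; rewrite /joe; case: eqP => [_|/eqP a0].
  by rewrite /comonotone_copula bigmin_eq_id // => i _; rewrite u1.
by rewrite big1 ?sib1 // => i _; rewrite u1 sib1 // invr_eq0.
Qed.

Lemma joe_single a n (u : 'I_n -> R) k : u k <= 1 ->
  (forall i, i != k -> u i = 1) -> joe a u = u k.
Proof.
move=> uk u1; rewrite /joe; case: eqP => [_|/eqP a0].
  rewrite /comonotone_copula (bigminD1 k) // bigmin_eq_id; first exact/min_idPl.
  by move=> i ik; rewrite u1.
rewrite (bigD1 k) //= big1 ?mulr1 ?sibK // => i ik.
by rewrite u1 // sib1 // invr_eq0.
Qed.

Lemma joe_pair a n (u : 'I_n -> R) k l : k != l ->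
  (forall i, i != k -> i != l -> u i = 1) -> joe a u = joe a (vec2 (u k) (u l)).
Proof.
move=> kl u1; rewrite /joe; case: eqP => [_|/eqP a0].
  rewrite /comonotone_copula (bigminD1 k) // (bigminD1 l) 1?eq_sym //=.
  rewrite bigmin_eq_id => [|i /andP[ik il]]; last by rewrite u1.
  by rewrite !big_ord_recl big_ord0.
rewrite (bigD1 k) //= (bigD1 l) //=; last by rewrite eq_sym.
rewrite big1 ?mulr1 => [|i /andP[ik il]]; last by rewrite u1 // sib1 // invr_eq0.
by rewrite !big_ord_recl big_ord0 mulr1.
Qed.

Lemma joe1 n (u : 'I_n -> R) : unit_cube u -> joe 1 u = \prod_i u i.
Proof.
move=> cu; have u1 i : u i <= 1 by case/andP: (cu i).
rewrite /joe oner_eq0 invr1 sib1l.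
  by apply: eq_bigr => i _; rewrite sib1l.
under eq_bigr => i _ do rewrite sib1l //.
by case/andP: (prod_itv cu).
Qed.

(** F may be inserted as an argument of any Joe copula of parameter b with
    a <= b <= 1.  For a = 0 this includes the comonotone copula, and F must be a
    minimum of variables.  A single variable is nestable at 0, so the arguments
    at leaves and at inner nodes need no separate treatment. *)
Definition joe_nestable a d (F : ('I_d -> R) -> R) : Prop :=
  (forall u, unit_cube u -> 0 <= F u <= 1) /\
  if a == 0 then exists S, comonotone_on S F
  else forall b, a <= b <= 1 -> cube_cdf (fun u => sib b^-1 (F u)).

Lemma joe_nestable_var d (i : 'I_d) : joe_nestable 0 (fun u => u i).
Proof.
split=> [u cu //|]; rewrite eqxx; exists (pred1 i) => u cu; split=> // s s01.
apply/idP/forallP => [su j|/(_ i)]; last by rewrite /= eqxx.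
by apply/implyP => /= /eqP ->.
Qed.

Lemma cube_cdf_nestable a b d (F : ('I_d -> R) -> R) :
  0 <= a <= b -> 0 < b <= 1 -> joe_nestable a F ->
  cube_cdf (fun u => sib b^-1 (F u)).
Proof.
move=> /andP[a0 ab] /andP[b0 b1] [F01]; case: eqP => [_ [S SF]|_ HF].
  apply: (@cube_cdf_comonotone _ _ S F (sib b) (sib b^-1)) => //.
  - exact: measurable_sib.
  - by move=> s s01; apply: sib_itv => //; apply: ltW.
  - by move=> s s01; apply: sib_itv => //; rewrite invr_ge0 ltW.
  - by move=> s t s01 t01; apply: sib_galois.
by apply: HF; rewrite ab b1.
Qed.

Lemma joe_nestable_joe a n d (F : 'I_n -> ('I_d -> R) -> R) :
  0 <= a <= 1 ->
  (forall k, exists2 b, 0 <= b <= a & joe_nestable b (F k)) ->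
  joe_nestable a (fun u => joe a (fun k => F k u)).
Proof.
move=> /andP[a0 a1] HF.
have F01 k u : unit_cube u -> 0 <= F k u <= 1.
  by move=> cu; have [b _ [H _]] := HF k; apply: H.
split=> [u cu|]; first by apply: joe_itv => // k; apply: F01.
rewrite /joe; case: eqP => [a00|/eqP a00].
  have /choice[S SF] : forall k, exists S, comonotone_on S (F k).
    move=> k; have [b b0 [_]] := HF k.
    by have -> : b = 0 by [move: b0; rewrite a00 -eq_le => /eqP]; rewrite eqxx.
  exists (fun i => [exists k, S k i]) => u cu; split.
    by apply: comonotone_itv => k; apply: F01.
  move=> s s01; apply/bigmin_geP/forallP => [[_ H] i|H].
    apply/implyP => /existsP[k Ski]; have := H k isT.
    by rewrite (SF k u cu).2 // => /forallP /(_ i); rewrite Ski.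
  split=> [|k _]; first by case/andP: s01.
  rewrite (SF k u cu).2 //; apply/forallP => i; apply/implyP => Ski.
  by apply: (implyP (H i)); apply/existsP; exists k.
have a_gt0 : 0 < a by rewrite lt_def a00.
move=> b /andP[ab b1]; have b0 : 0 < b by apply: lt_le_trans ab.
apply: (@cube_cdf_ext _ _ (fun u => sib (a / b) (\prod_k sib a^-1 (F k u)))).
  by move=> u _; rewrite sib_comp.
apply: cube_cdf_sib; first by rewrite divr_gt0 //= ler_pdivrMr // mul1r.
apply: cube_cdf_prod => k _; have [c ca HFk] := HF k.
by apply: cube_cdf_nestable HFk; rewrite ?a_gt0.
Qed.

Lemma cube_cdf_of_nestable a d (F : ('I_d -> R) -> R) :
  0 <= a <= 1 -> joe_nestable a F -> cube_cdf F.
Proof.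
move=> /andP[a0 a1] HF; have := @cube_cdf_nestable a 1 d F _ _ HF.
rewrite a0 a1 ltr01 lexx => /(_ isT isT); apply: cube_cdf_ext => u cu.
by rewrite invr1 sib1l //; case/andP: (HF.1 u cu).
Qed.

Lemma cube_cdf_joe a n : 0 <= a <= 1 -> cube_cdf (@joe a n).
Proof.
move=> a01; apply: (cube_cdf_of_nestable a01).
apply: (@joe_nestable_joe a n n (fun k u => u k)) => // k; exists 0.
  by rewrite lexx; case/andP: a01.
exact: joe_nestable_var.
Qed.

End Joe.

(** * Random vectors with uniform margins *)

Section UniformMargins.
Context {R : realType}.

(** The distribution function of the uniform law on [0, 1] *)
Definition clamp (t : R) : R := Num.max 0 (Num.min t 1).

Lemma clamp_itv t : 0 <= clamp t <= 1.
Proof. by rewrite /clamp le_max lexx /= ge_max ler01 ge_min lexx orbT. Qed.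

Lemma clamp_id t : 0 <= t <= 1 -> clamp t = t.
Proof. by move=> /andP[t0 t1]; rewrite /clamp (min_idPl t1) (max_idPr t0). Qed.

Lemma clamp_le x t : 0 < x <= 1 -> (x <= clamp t) = (x <= t).
Proof.
by move=> /andP[x0 x1]; rewrite /clamp le_max le_min x1 andbT leNgt x0.
Qed.

Lemma continuous_clamp : continuous clamp.
Proof.
move=> t.
have cst_c (c : R) : {for t, continuous (fun _ : R => c : R^o)}.
  exact: cst_continuous.
have min_c : {for t, continuous (fun s : R => Num.min s 1 : R^o)}.
  apply: (@continuous_min _ _ (id : R -> R^o) (fun=> 1)) => //; exact: cvg_id.
exact: (continuous_max (cst_c 0) min_c).
Qed.

Section Probability.
Context {dp : measure_display} {O : measurableType dp} (Pr : probability O R).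

Lemma probability_setI1 (A B : set O) : measurable A -> measurable B ->
  Pr B = 1%E -> Pr (A `&` B) = Pr A.
Proof.
move=> mA mB B1; rewrite [in RHS](measureDI _ mA mB).
rewrite [X in (X + _)%E](_ : _ = 0%E) ?add0e //.
apply/eqP; rewrite eq_le measure_ge0 andbT.
have <- : Pr (~` B) = 0%E by rewrite probability_setC // B1 subee.
by apply: le_measure; rewrite ?inE;
  [exact: measurableD|exact: measurableC|move=> w []].
Qed.

(** Uniform on [0, 1], in terms of the distribution function *)
Definition uniform_margin (X : {RV Pr >-> R}) : Prop :=
  forall t, 0 <= t <= 1 -> cdf X t = t%:E.

Lemma measurable_RV_le (X : {RV Pr >-> R}) t : measurable [set w | X w <= t].
Proof.
rewrite (_ : [set _ | _] = X @^-1` `]-oo, t]).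
  by rewrite -[X in measurable X]setTI; apply: measurable_funP.
by apply/seteqP; split=> w /=; rewrite in_itv.
Qed.

Lemma cdfE (X : {RV Pr >-> R}) t : cdf X t = Pr [set w | X w <= t].
Proof.
by rewrite /cdf /distribution /pushforward -set_itvNyc.
Qed.

Lemma cdf_uniform_margin (X : {RV Pr >-> R}) t :
  uniform_margin X -> cdf X t = (clamp t)%:E.
Proof.
move=> UX; have [t0|t0] := ltrP t 0.
  have -> : clamp t = 0 by apply/max_idPl; rewrite ge_min (ltW t0).
  apply/eqP; rewrite eq_le cdf_ge0 andbT.
  have <- : cdf X 0 = 0%:E by rewrite UX ?lexx ?ler01.
  by apply: cdf_nondecreasing; apply: ltW.
have [t1|t1] := lerP t 1; first by rewrite clamp_id ?UX ?t0.
have -> : clamp t = 1 by rewrite /clamp (min_idPr (ltW t1)); apply/max_idPr.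
apply/eqP; rewrite eq_le cdf_le1 /=.
have <- : cdf X 1 = 1%:E by rewrite UX ?lexx ?ler01.
by apply: cdf_nondecreasing; apply: ltW.
Qed.

Lemma continuous_uniform_margin (X : {RV Pr >-> R}) :
  uniform_margin X -> continuous_margin X.
Proof.
move=> UX; rewrite /continuous_margin (_ : cdf X = EFin \o clamp).
  by move=> t; apply: cvg_EFin; [near=> s|exact: continuous_clamp].
by apply/funext => t /=; apply: cdf_uniform_margin.
Unshelve. all: by end_near. Qed.

(** Uniform variables lie in ]0, 1] almost surely, where clamping a bound does
    not change the corresponding event. *)
Lemma uniform_margin_range n (X : 'I_n -> {RV Pr >-> R}) :
  (forall i, uniform_margin (X i)) ->
  measurable [set w | forall i, 0 < X i w <= 1] /\
  Pr [set w | forall i, 0 < X i w <= 1] = 1%E.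
Proof.
move=> UX.
pose G := fun i => [set w | X i w <= 1] `\` [set w | X i w <= 0].
have mG i : measurable (G i) by apply: measurableD; exact: measurable_RV_le.
have G1 i : Pr (G i) = 1%E.
  have c1 := cdfE (X i) 1; have c0 := cdfE (X i) 0.
  rewrite !UX ?lexx ?ler01 // in c1 c0.
  have [m1 m0] := (measurable_RV_le (X i) 1, measurable_RV_le (X i) 0).
  rewrite [RHS]c1 [RHS](measureDI _ m1 m0).
  rewrite (_ : [set w | X i w <= 1] `&` _ = [set w | X i w <= 0]).
    by rewrite -[X in (_ + X)%E]c0 adde0.
  apply/seteqP; split=> w /=; first by case.
  by move=> H; split=> //; apply: le_trans H _.
suff [mS S1] :
    measurable [set w | forall i, i \in enum 'I_n -> 0 < X i w <= 1] /\
    Pr [set w | forall i, i \in enum 'I_n -> 0 < X i w <= 1] = 1%E.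
  rewrite (_ : [set w | forall i, 0 < X i w <= 1] =
    [set w | forall i, i \in enum 'I_n -> 0 < X i w <= 1]) //.
  apply/seteqP; split=> w /= H i; first by move=> _; apply: H.
  by apply: H; rewrite mem_enum.
elim: (enum 'I_n) => [|j r [IHm IH]].
  rewrite (_ : [set _ | _] = setT); last by apply/seteqP; split=> w.
  by rewrite probability_setT.
rewrite (_ : [set _ | _] =
    [set w | forall i, i \in r -> 0 < X i w <= 1] `&` G j).
  split; first exact: measurableI.
  by rewrite probability_setI1.
apply/seteqP; split=> w /=.
  move=> H; split=> [i ir|]; first by apply: H; rewrite in_cons ir orbT.
  have /andP[X0 X1] := H j (mem_head _ _).
  by split=> //=; apply/negP; rewrite -ltNge.
move=> [H [/= X1 /negP]]; rewrite -ltNge => X0 i.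
by rewrite in_cons => /orP[/eqP->|]; [rewrite X0 X1|apply: H].
Qed.

Lemma joint_cdf_clamp n (X : 'I_n -> {RV Pr >-> R}) x :
  (forall i, uniform_margin (X i)) -> joint_cdf X x = joint_cdf X (clamp \o x).
Proof.
move=> UX; have [mG G1] := uniform_margin_range UX.
have m y : measurable [set w | forall i, X i w <= y i].
  by apply: measurable_le => i; apply: measurable_funPT.
rewrite /joint_cdf -(probability_setI1 (m x) mG G1).
rewrite -(probability_setI1 (m (clamp \o x)) mG G1); congr (Pr _).
by apply/seteqP; split=> w /= [H Gw]; split=> // i; move: (H i) (Gw i) => /=;
  move=> Hi Gi; rewrite ?clamp_le // in Hi *.
Qed.

(** A vector with uniform margins is a representation of its own copula. *)
Lemma uniform_margin_copula_of n (X : 'I_n -> {RV Pr >-> R}) C :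
  (forall i, uniform_margin (X i)) ->
  (forall u, unit_cube u -> joint_cdf X u = (C u)%:E) ->
  copula_of X C.
Proof.
move=> UX XC; split; first by exists dp, O, Pr, X.
move=> x; rewrite joint_cdf_clamp // XC => [|i]; last exact: clamp_itv.
by congr (C _)%:E; apply/funext => i; rewrite cdf_uniform_margin.
Qed.

End Probability.

Definition coord n (P : probability (n.-tuple R) R) (i : 'I_n) : {RV P >-> R} :=
  HB.pack (fun w : n.-tuple R => tnth w i)
    (isMeasurableFun.Build _ _ _ _ (fun w : n.-tuple R => tnth w i)
      (measurable_tnth i)).

Lemma cdf_coord n (P : probability (n.-tuple R) R) (C : ('I_n -> R) -> R)
    (i : 'I_n) (t : R) :
  (forall u, unit_cube u -> P [set w | forall i, tnth w i <= u i] = (C u)%:E) ->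
  C (fun=> 1) = 1 -> 0 <= t <= 1 ->
  cdf (coord P i) t = (C (fun j => if j == i then t else 1))%:E.
Proof.
move=> PC C1 t01; have one01 : 0 <= (1 : R) <= 1 by rewrite ler01 lexx.
rewrite -PC => [|j]; last by case: ifP.
rewrite cdfE -(@probability_setI1 _ _ P _ [set w | forall i, tnth w i <= 1]).
- congr (P _); apply/seteqP; split=> w /=.
    by move=> [Hi H1] j; case: eqP => [->|].
  move=> H; split; first by have := H i; rewrite eqxx.
  move=> j; have := H j; case: eqP => // _ Hj; apply: (le_trans Hj).
  by case/andP: t01.
- exact: (measurable_RV_le (coord P i)).
- exact: (measurable_orthant (fun=> 1)).
- by rewrite (PC (fun=> 1)) ?C1.
Qed.

(** A distribution function on the cube with uniform margins is a copula,
    realised by the coordinates of a law on R^n. *)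
Lemma cube_cdf_copula n (C : ('I_n -> R) -> R) : cube_cdf C ->
  (forall u i, unit_cube u -> (forall j, j != i -> u j = 1) -> C u = u i) ->
  exists P : probability (n.-tuple R) R,
    [/\ forall i, uniform_margin (coord P i),
        forall u, unit_cube u -> joint_cdf (coord P) u = (C u)%:E &
        copula_of (coord P) C].
Proof.
move=> [P PC] C1; exists P.
have one01 : 0 <= (1 : R) <= 1 by rewrite ler01 lexx.
have U i : uniform_margin (coord P i).
  have C11 : C (fun=> 1) = 1 by rewrite (C1 _ i).
  move=> t t01; rewrite (cdf_coord i PC C11 t01) (C1 _ i) ?eqxx //.
    by move=> j; case: ifP.
  by move=> j /negbTE ->.
by split=> //; apply: uniform_margin_copula_of.
Qed.

Lemma is_copula_joe a n : 0 <= a <= 1 -> is_copula (@joe R a n).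
Proof.
move=> a01; have [|P [_ _ []//]] := cube_cdf_copula (cube_cdf_joe n a01).
by move=> u i cu u1; apply: joe_single => //; case/andP: (cu i).
Qed.

End UniformMargins.

(** * Joe copulas are Archimedean *)

Section Generator.
Context {R : realType}.
Implicit Types (a x y : R).

Lemma continuous_norm_powR a : 0 < a -> continuous (fun x : R => `|x| `^ a).
Proof.
move=> a0 x; have [->|x0] := eqVneq x 0.
  rewrite /continuous_at normr0 powR0 ?gt_eqF //.
  apply/cvgrPdist_lt => e e0.
  near=> y; rewrite sub0r normrN ger0_norm ?powR_ge0 //.
  rewrite -[ltRHS](powRr1 (ltW e0)) -(mulVf (lt0r_neq0 a0)) powRrM.
  rewrite gt0_ltr_powR ?nnegrE ?powR_ge0 //.
  near: y.
  have /cvgrPdist_lt /(_ (e `^ a^-1)) := @cvg_id _ (nbhs (0 : R)).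
  rewrite powR_gt0 // => /(_ isT); apply: filterS => y.
  by rewrite sub0r normrN.
apply: (@cvg_comp _ _ _ (fun x : R => `|x|) (fun z : R => z `^ a)
  (nbhs x) (nbhs `|x|)).
  by apply: cvg_norm; exact: cvg_id.
have H : derivable (fun z : R => z `^ a) `|x| 1.
  by apply: derivable_powR; rewrite in_itv /= normr_gt0 x0.
exact: (differentiable_continuous (proj1 (derivable1_diffP _ _) H)).
Unshelve. all: by end_near. Qed.

(** The absolute value makes the function continuous beyond x = 1, where [powR]
    takes the value 1 on negative numbers. *)
Lemma continuous_sib_norm a : 0 < a ->
  continuous (fun x : R => 1 - `|1 - x| `^ a).
Proof.
move=> a0 x; apply: cvgB; first exact: cvg_cst.
apply: (@cvg_comp _ _ _ (fun x : R => 1 - x) (fun x : R => `|x| `^ a)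
  (nbhs x) (nbhs (1 - x))).
  by apply: cvgB; [exact: cvg_cst|exact: cvg_id].
exact: continuous_norm_powR.
Qed.

Lemma sib_normE a x : x <= 1 -> sib a x = 1 - `|1 - x| `^ a.
Proof. by move=> x1; rewrite ger0_norm // subr_ge0. Qed.

Lemma sib_lt a x y : 0 < a -> x < y -> y <= 1 -> sib a x < sib a y.
Proof.
move=> a0 xy y1; rewrite /sib ltrD2l ltrN2 gt0_ltr_powR ?nnegrE ?subr_ge0 //.
  by apply: le_trans y1; apply: ltW.
by rewrite ltrD2l ltrN2.
Qed.

(** exp(- t) on [0, +oo]; the value at -oo is irrelevant. *)
Definition expRN (t : \bar R) : R := if t is r%:E then expR (- r) else 0.

Lemma expRN_itv (t : \bar R) : (0 <= t)%E -> 0 <= expRN t <= 1.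
Proof.
case: t => [r||] //= r0; last by rewrite lexx ler01.
by rewrite expR_ge0 expR_le1 oppr_le0.
Qed.

Lemma expRND (s t : \bar R) : (0 <= s)%E -> (0 <= t)%E ->
  expRN (s + t)%E = expRN s * expRN t.
Proof.
case: s t => [s||] [t||] //= s0 t0; rewrite ?mulr0 ?mul0r //.
by rewrite opprD expRD.
Qed.

Lemma expRN_sum (I : Type) (r : seq I) (F : I -> \bar R) :
  (forall i, (0 <= F i)%E) ->
  expRN (\sum_(i <- r) F i)%E = \prod_(i <- r) expRN (F i).
Proof.
move=> F0; elim: r => [|i r IH]; first by rewrite !big_nil /= oppr0 expR0.
by rewrite !big_cons expRND ?IH //; apply: sume_ge0.
Qed.

Lemma expRN_le (s t : \bar R) : (0 <= s)%E -> (s <= t)%E -> expRN t <= expRN s.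
Proof.
case: s t => [s||] [t||] //= s0 st; rewrite ?expR_ge0 //.
by rewrite ler_expR lerN2.
Qed.

Lemma expRN_lt (s t : \bar R) : (0 <= s)%E -> (s < t)%E -> expRN t < expRN s.
Proof.
case: s t => [s||] [t||] //= s0 st; rewrite ?expR_gt0 //.
by rewrite ltr_expR ltrN2.
Qed.

Lemma expRN_inj (s t : \bar R) : (0 <= s)%E -> (0 <= t)%E ->
  expRN s = expRN t -> s = t.
Proof.
move=> s0 t0 st; apply/eqP; apply: contra_eqT st => /lt_total/orP[] H.
  by rewrite gt_eqF // expRN_lt.
by rewrite lt_eqF // expRN_lt.
Qed.

(** The generator of the Joe copula *)
Definition joe_psi a (t : \bar R) : R := sib a (expRN t).

Lemma generator_joe_psi a : 0 < a -> archimedean_generator (joe_psi a).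
Proof.
move=> a0; rewrite /joe_psi.
have le1 (t : \bar R) : (0 <= t)%E -> expRN t <= 1.
  by move=> /expRN_itv /andP[].
split.
- by rewrite /= oppr0 expR0 sib1 // gt_eqF.
- by rewrite /= sib0.
- rewrite /= sib0.
  have : (1 - `|1 - expR (- t)| `^ a) @[t --> +oo] --> (0 : R).
    have -> : 0 = 1 - `|1 - 0| `^ a :> R by rewrite subr0 normr1 powR1 subrr.
    apply: (@cvg_comp _ _ _ (fun t : R => expR (- t))
      (fun x : R => 1 - `|1 - x| `^ a) _ _ _ (@cvgr_expR R)).
    exact: continuous_sib_norm.
  apply: cvg_trans; apply: near_eq_cvg; near=> t.
  by rewrite /= sib_normE // expR_le1 oppr_le0.
- apply: (@subspace_eq_continuous _ _ _
    (fun t : R => 1 - `|1 - expR (- t)| `^ a)).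
    move=> t; rewrite inE /= in_itv /= andbT => t0.
    by rewrite /from_subspace sib_normE // expR_le1 oppr_le0.
  apply: continuous_subspaceT => t.
  apply: (@cvg_comp _ _ _ (fun t : R => expR (- t))
    (fun x : R => 1 - `|1 - x| `^ a) (nbhs t) (nbhs (expR (- t)))).
    apply: (@cvg_comp _ _ _ (fun t : R => - t) (@expR R) (nbhs t) (nbhs (- t))).
      by apply: cvgN; exact: cvg_id.
    exact: continuous_expR.
  exact: continuous_sib_norm.
- move=> s t s0 st; apply: sib_le; rewrite ?(ltW a0) ?le1 ?(le_trans s0) //.
  exact: expRN_le.
- move=> s t s0 st _; apply: sib_lt; rewrite ?le1 //.
  exact: expRN_lt.
Unshelve. all: by end_near. Qed.

Lemma generator_inv_joe a x : 0 < a -> 0 <= x <= 1 ->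
  (0 <= generator_inv (joe_psi a) x)%E /\
  expRN (generator_inv (joe_psi a) x) = sib a^-1 x.
Proof.
move=> a0 x01; have ai0 : 0 <= a^-1 by rewrite invr_ge0 ltW.
have /andP[z0 z1] := sib_itv ai0 x01; set z := sib a^-1 x in z0 z1 *.
have [t t0 tz] : exists2 t : \bar R, (0 <= t)%E & expRN t = z.
  have [z_gt0|z_le0] := ltrP 0 z.
    exists (- ln z)%:E; first by rewrite lee_fin oppr_ge0 ln_le0.
    by rewrite /= opprK lnK.
  by exists +oo%E => //=; apply/eqP; rewrite eq_le z0.
suff -> : generator_inv (joe_psi a) x = t by [].
rewrite /generator_inv (_ : [set _ | _] = [set t]) ?ereal_inf1 //.
have le1 (s : \bar R) : (0 <= s)%E -> expRN s <= 1 by move=> /expRN_itv /andP[].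
apply/seteqP; split=> s /= => [[s0 sx]|->].
  apply: expRN_inj => //; rewrite tz /z -sx /joe_psi.
  by rewrite -[in sib a _](invrK a) sibK ?le1 // invr_eq0 gt_eqF.
by split=> //; rewrite /joe_psi tz sibK ?gt_eqF //; case/andP: x01.
Qed.

Lemma archimedean_joe a n : 0 <= a <= 1 -> archimedean_copula (@joe R a n).
Proof.
move=> /[dup] a01 /andP[a0 a1]; split; first exact: is_copula_joe.
have [->|a_neq0] := eqVneq a 0; first by constructor 3 => u _; rewrite /joe eqxx.
have {}a0 : 0 < a by rewrite lt_def a_neq0.
constructor 1; exists (joe_psi a); first exact: generator_joe_psi.
move=> u cu; rewrite /joe (negbTE a_neq0) /archimedean /joe_psi.
rewrite expRN_sum => [|i]; last by have [] := generator_inv_joe a0 (cu i).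
congr (sib a _); apply: eq_bigr => i _.
by have [_ ->] := generator_inv_joe a0 (cu i).
Qed.

End Generator.

(** * Continuity in the parameter *)

Section ParameterContinuity.
Context {R : realType}.
Implicit Types (a b x y : R).

Lemma continuous_powRr x b : 0 <= x -> 0 < b -> (x `^ c) @[c --> b] --> x `^ b.
Proof.
move=> x0 b0; have [->|xn0] := eqVneq x 0.
  have : (0 : R) @[_ --> b] --> (0 : R) by exact: cvg_cst.
  rewrite powR0 ?gt_eqF //; apply: cvg_trans; apply: near_eq_cvg.
  near=> c; rewrite powR0 // gt_eqF //.
  by near: c; exact: lt_nbhsr.
rewrite /powR (negbTE xn0).
apply: (@cvg_comp _ _ _ (fun c : R => c * ln x) (@expR R)
  (nbhs b) (nbhs (b * ln x))).
  by apply: cvgM; [exact: cvg_id|exact: cvg_cst].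
exact: continuous_expR.
Unshelve. all: by end_near. Qed.

Lemma cvg_powR (f g : R -> R) (F : set_system R) {FF : Filter F} x b :
  0 < x -> f @ F --> x -> g @ F --> b -> (f t `^ g t) @[t --> F] --> x `^ b.
Proof.
move=> x0 fx gb; have : (expR (g t * ln (f t))) @[t --> F] --> x `^ b.
  rewrite /powR gt_eqF //.
  apply: (@cvg_comp _ _ _ (fun t : R => g t * ln (f t)) (@expR R)
    F (nbhs (b * ln x))).
    apply: cvgM => //; apply: (@cvg_comp _ _ _ f (@ln R) F (nbhs x)) => //.
    exact: continuous_ln.
  exact: continuous_expR.
apply: cvg_trans; apply: near_eq_cvg.
have : \forall t \near F, 0 < f t by apply: (cvgr_gt _ fx).
by apply: filterS => t ft; rewrite /powR gt_eqF.
Qed.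

Lemma ord2P (i : 'I_2) : i = 0 \/ i = 1.
Proof. by case: i => -[|[|//]] i; [left|right]; apply/val_inj. Qed.

Lemma joe2E a (u : 'I_2 -> R) : a != 0 ->
  joe a u = 1 - (1 - (1 - (1 - u 0) `^ a^-1) * (1 - (1 - u 1) `^ a^-1)) `^ a.
Proof.
move=> a0; rewrite /joe (negbTE a0) !big_ord_recl big_ord0 mulr1 /sib.
by rewrite (_ : lift _ _ = 1) //; apply/val_inj.
Qed.

Lemma comonotone2E (u : 'I_2 -> R) : unit_cube u ->
  comonotone_copula u = 1 - Num.max (1 - u 0) (1 - u 1).
Proof.
move=> cu; rewrite /comonotone_copula !big_ord_recl big_ord0.
rewrite (_ : lift _ _ = 1); last exact/val_inj.
rewrite (min_idPl (proj2 (andP (cu 1)))).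
by case: (leP (u 0) (u 1)) => H; [rewrite max_l|rewrite max_r];
  rewrite ?lerD2l ?lerN2 ?(ltW H) //; ring.
Qed.

(** For a > 0, write C_a(u) = 1 - s^a and let M be the larger of 1 - u_0 and
    1 - u_1; then s lies between M^(1/a) and 2 M^(1/a). *)
Lemma joe_comonotone_dist a (u : 'I_2 -> R) : 0 <= a -> unit_cube u ->
  `|comonotone_copula u - joe a u| <= 2 `^ a - 1.
Proof.
rewrite le_eqVlt => /orP[/eqP <-|a0] cu.
  by rewrite /joe eqxx subrr normr0 powRr0 subrr.
have /andP[u00 u01] := cu 0; have /andP[u10 u11] := cu 1.
rewrite comonotone2E // joe2E ?gt_eqF //.
set x := 1 - u 0; set y := 1 - u 1; pose M := Num.max x y.
have x01 : 0 <= x <= 1 by rewrite subr_ge0 u01 gerBl.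
have y01 : 0 <= y <= 1 by rewrite subr_ge0 u11 gerBl.
have M0 : 0 <= M by rewrite le_max; case/andP: x01 => ->.
have M1 : M <= 1 by rewrite ge_max; case/andP: x01 => _ ->; case/andP: y01.
have ai0 : 0 <= a^-1 by rewrite invr_ge0 ltW.
set p := x `^ a^-1; set q := y `^ a^-1.
have le1 z : 0 <= z <= 1 -> z `^ a^-1 <= 1.
  move=> /andP[z0 z1]; suff : z `^ a^-1 <= 1 `^ a^-1 by rewrite powR1.
  by rewrite ge0_ler_powR ?nnegrE.
have p0 : 0 <= p by exact: powR_ge0.
have q0 : 0 <= q by exact: powR_ge0.
have p1 : p <= 1 by exact: le1.
have q1 : q <= 1 by exact: le1.
have MK : (M `^ a^-1) `^ a = M by rewrite -powRrM mulVf ?gt_eqF // powRr1.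
set N := M `^ a^-1 in MK.
have Npq : N = p \/ N = q.
  by rewrite /N /M /p /q; case: (leP x y) => _; [right|left].
have pN : p <= N.
  by rewrite ge0_ler_powR ?nnegrE //; [case/andP: x01|rewrite le_max lexx].
have qN : q <= N.
  by rewrite ge0_ler_powR ?nnegrE //; [case/andP: y01|rewrite le_max lexx orbT].
have N0 : 0 <= N by exact: powR_ge0.
set s := 1 - _ * _.
have sN : N <= s by rewrite /s; case: Npq => ->; nra.
have s2N : s <= 2 * N by rewrite /s; nra.
have lo : M <= s `^ a.
  by rewrite -MK ge0_ler_powR ?nnegrE ?(ltW a0) // (le_trans N0).
have hi : s `^ a <= 2 `^ a * M.
  rewrite -MK -powRM // ge0_ler_powR ?nnegrE ?(ltW a0) ?mulr_ge0 //.
  exact: le_trans sN.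
have t1 : 1 <= 2 `^ a :> R.
  by have := @ler_powR R 2 _ 0 a (ltW a0); rewrite powRr0; apply; rewrite ler1n.
rewrite -/M ger0_norm; last lra.
nra.
Qed.

Lemma continuous_joe_param (u : 'I_2 -> R) : unit_cube u ->
  continuous (fun a : R => joe (clamp a) u).
Proof.
move=> cu a; have /andP[c0 c1] := clamp_itv a.
have [ca0|ca0] := eqVneq (clamp a) 0.
  have c2 : (2 `^ clamp t - 1) @[t --> a] --> (0 : R).
    have -> : 0 = 2 `^ (clamp a) - 1 :> R by rewrite ca0 powRr0 subrr.
    apply: cvgB; last exact: cvg_cst.
    by apply: cvg_powR => //; [exact: cvg_cst|exact: continuous_clamp].
  rewrite /continuous_at /joe ca0 eqxx -/(joe _ _).
  apply/cvgrPdist_le => e e0.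
  have /cvgrPdist_le /(_ e e0) := c2; apply: filterS => t.
  rewrite sub0r normrN => /(le_trans (ler_norm _)); apply: le_trans.
  by apply: joe_comonotone_dist => //; case/andP: (clamp_itv t).
have c_gt0 : 0 < clamp a by rewrite lt_def ca0.
apply: (@cvg_comp _ _ _ clamp (fun b : R => joe b u) (nbhs a) (nbhs (clamp a))).
  exact: continuous_clamp.
set c := clamp a in ca0 c_gt0 *.
have /andP[u00 u01] := cu 0; have /andP[u10 u11] := cu 1.
have [u1|nu1] := pselect (u 0 = 1 /\ u 1 = 1).
  have j1 b : joe b u = 1.
    by rewrite joe_const1 // => i; case: (ord2P i) => ->; case: u1.
  by rewrite j1 (_ : (fun b => joe b u) = fun=> 1) ?funeqE //; exact: cvg_cst.
rewrite joe2E //.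
have: (1 - (1 - (1 - (1 - u 0) `^ b^-1) * (1 - (1 - u 1) `^ b^-1)) `^ b)
    @[b --> c] -->
  1 - (1 - (1 - (1 - u 0) `^ c^-1) * (1 - (1 - u 1) `^ c^-1)) `^ c.
  apply: cvgB; first exact: cvg_cst.
  have inv_c : (fun b : R => b^-1) @ c --> c^-1.
    by apply: cvgV => //; exact: cvg_id.
  have pw x : 0 <= x -> (x `^ b^-1) @[b --> c] --> x `^ c^-1.
    move=> x0; apply: (@cvg_comp _ _ _ (fun b : R => b^-1) (powR x)
      (nbhs c) (nbhs c^-1)) => //.
    by apply: continuous_powRr; rewrite ?invr_gt0.
  apply: cvg_powR => //; last first.
    apply: cvgB; first exact: cvg_cst.
    by apply: cvgM; apply: cvgB;
      first [exact: cvg_cst|apply: pw; rewrite subr_ge0].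
  have le1 z : 0 <= z <= 1 -> 0 <= (1 - z) `^ c^-1 <= 1.
    have ci0 : 0 <= c^-1 by rewrite invr_ge0.
    by move=> z01; rewrite powR_ge0 /= -subr_ge0; case/andP: (sib_itv ci0 z01).
  have gt0 z : z <= 1 -> z <> 1 -> 0 < (1 - z) `^ c^-1.
    by move=> z1 /eqP nz; rewrite powR_gt0 // subr_gt0 lt_neqAle nz.
  have /andP[p0 p1] := le1 _ (cu 0); have /andP[q0 q1] := le1 _ (cu 1).
  have [u0n|u0n] := pselect (u 0 = 1).
    have /(gt0 _ u11) : u 1 <> 1 by move=> u1n; apply: nu1.
    nra.
  have := gt0 _ u01 u0n; nra.
apply: cvg_trans; apply: near_eq_cvg; near=> b.
rewrite joe2E // gt_eqF //; near: b; exact: lt_nbhsr.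
Unshelve. all: by end_near. Qed.

End ParameterContinuity.

(** * Measures of concordance along the Joe family *)

Section Concordance.
Context {R : realType} (kappa : concordance_map R).
Hypothesis kappaP : measure_of_concordance kappa.

(** X and Y are uniform on [0, 1], coupled by the Joe copula of parameter a. *)
Definition joe_pair_law {dp : measure_display} {O : measurableType dp}
    {Pr : probability O R} (a : R) (X Y : {RV Pr >-> R}) : Prop :=
  [/\ uniform_margin X, uniform_margin Y &
      forall u, unit_cube u -> joint_cdf (rv_pair X Y) u = (joe a u)%:E].

Lemma joe_pair_law_copula {dp : measure_display} {O : measurableType dp}
    {Pr : probability O R} (a : R) (X Y : {RV Pr >-> R}) :
  joe_pair_law a X Y -> copula_of (rv_pair X Y) (@joe R a 2).
Proof.
move=> [UX UY XY]; apply: uniform_margin_copula_of => // i.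
by rewrite /rv_pair; case: eqP.
Qed.

Lemma kappa_joe_pair_law {dp dp' : measure_display} {O : measurableType dp}
    {O' : measurableType dp'} {Pr : probability O R} {Pr' : probability O' R}
    (a : R) (X Y : {RV Pr >-> R}) (X' Y' : {RV Pr' >-> R}) :
  joe_pair_law a X Y -> joe_pair_law a X' Y' -> kappa X Y = kappa X' Y'.
Proof.
move=> L L'; have [UX UY _] := L; have [UX' UY' _] := L'.
have cX := continuous_uniform_margin UX.
have cY := continuous_uniform_margin UY.
have cX' := continuous_uniform_margin UX'.
have cY' := continuous_uniform_margin UY'.
have [C C'] := (joe_pair_law_copula L, joe_pair_law_copula L').
apply/eqP; rewrite eq_le (moc_mono kappaP cX cY cX' cY' C C') //.
by rewrite (moc_mono kappaP cX' cY' cX cY C' C).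
Qed.

Lemma rv_pair_coord (P : probability (2.-tuple R) R) :
  rv_pair (coord P 0) (coord P 1) = coord P.
Proof. by apply/funext => i; case: (ord2P i) => ->. Qed.

Lemma joe_pair_law_exists : exists P : R -> probability (2.-tuple R) R,
  forall a, joe_pair_law (clamp a) (coord (P a) 0) (coord (P a) 1).
Proof.
suff /choice : forall a, exists P : probability (2.-tuple R) R,
  joe_pair_law (clamp a) (coord P 0) (coord P 1).
  by move=> [P PL]; exists P.
move=> a; have a01 := clamp_itv a.
have [|P [UP PJ _]] := cube_cdf_copula (cube_cdf_joe 2 a01).
  by move=> u i cu u1; apply: joe_single => //; case/andP: (cu i).
by exists P; split=> //; rewrite rv_pair_coord.
Qed.

Lemma kappa_joe0 (dp : measure_display) (O : measurableType dp)
    (Pr : probability O R) (X Y : {RV Pr >-> R}) :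
  joe_pair_law 0 X Y -> kappa X Y = 1.
Proof.
move=> L; have [UX UY _] := L.
apply: (moc_comonotone kappaP); [exact: continuous_uniform_margin..|].
have := joe_pair_law_copula L; congr copula_of.
by apply/funext => u; rewrite /joe eqxx.
Qed.

(** Independent uniform variables, the coordinates of a product measure, realise
    the parameter 1. *)
Lemma kappa_joe1 (dp : measure_display) (O : measurableType dp)
    (Pr : probability O R) (X Y : {RV Pr >-> R}) :
  joe_pair_law 1 X Y -> kappa X Y = 0.
Proof.
move=> L; have [UX UY _] := L; pose Q := (Pr \x Pr)%E : probability _ R.
have mX : measurable_fun setT (X \o fst : O * O -> R).
  by apply: measurableT_comp.
have mY : measurable_fun setT (Y \o snd : O * O -> R).
  by apply: measurableT_comp.
pose X' : {RV Q >-> R} := HB.pack (X \o fst : O * O -> R)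
  (isMeasurableFun.Build _ _ _ _ (X \o fst : O * O -> R) mX).
pose Y' : {RV Q >-> R} := HB.pack (Y \o snd : O * O -> R)
  (isMeasurableFun.Build _ _ _ _ (Y \o snd : O * O -> R) mY).
have QE A B : measurable A -> measurable B ->
    Q (X' @^-1` A `&` Y' @^-1` B) = (Pr (X @^-1` A) * Pr (Y @^-1` B))%E.
  move=> mA mB; rewrite -product_measure1E //.
    by rewrite -[X in measurable X]setTI; apply: measurable_funP.
  by rewrite -[X in measurable X]setTI; apply: measurable_funP.
have QX A : measurable A -> Q (X' @^-1` A) = Pr (X @^-1` A).
  move=> mA; have := QE A setT mA measurableT.
  by rewrite !preimage_setT setIT probability_setT mule1.
have QY A : measurable A -> Q (Y' @^-1` A) = Pr (Y @^-1` A).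
  move=> mA; have := QE setT A measurableT mA.
  by rewrite !preimage_setT setTI probability_setT mul1e.
have UX' : uniform_margin X' by move=> t t01; rewrite -(UX _ t01); apply: QX.
have UY' : uniform_margin Y' by move=> t t01; rewrite -(UY _ t01); apply: QY.
rewrite (@kappa_joe_pair_law _ _ _ _ _ _ 1 _ _ X' Y' L).
  apply: (moc_independent kappaP); [exact: continuous_uniform_margin..|].
  by move=> A B mA mB; rewrite QE // QX // QY.
split=> // u cu; rewrite joe1 // !big_ord_recl big_ord0 mulr1 EFinM.
rewrite (_ : lift _ _ = 1); last exact/val_inj.
rewrite -(UX _ (cu 0)) -(UY _ (cu 1)).
transitivity (Q (X' @^-1` `]-oo, u 0] `&` Y' @^-1` `]-oo, u 1])); last exact: QE.
congr (Q _); apply/seteqP; split=> w /=; rewrite !in_itv /=.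
  by move=> H; split; [exact: (H 0)|exact: (H 1)].
by move=> [H0 H1] i; case: (ord2P i) => ->.
Qed.

Lemma continuous_kappa_joe (P : R -> probability (2.-tuple R) R) :
  (forall a, joe_pair_law (clamp a) (coord (P a) 0) (coord (P a) 1)) ->
  continuous (fun a => kappa (coord (P a) 0) (coord (P a) 1)).
Proof.
move=> PL a; apply/(@cvg_nbhsP R R^o) => s sa.
have U b i : uniform_margin (coord (P b) i).
  by have [U0 U1 _] := PL b; case: (ord2P i) => ->.
apply: (moc_continuous kappaP) => [k|k|||x]; try exact: continuous_uniform_margin.
have E b : joint_cdf (rv_pair (coord (P b) 0) (coord (P b) 1)) x =
    (joe (clamp b) (clamp \o x))%:E.
  rewrite joint_cdf_clamp => [|i]; last by rewrite rv_pair_coord.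
  by have [_ _ ->] := PL b => // i; apply: clamp_itv.
rewrite E; under eq_fun do rewrite E.
apply: cvg_EFin; first by near=> k.
apply: (@cvg_comp _ _ _ s (fun b : R => joe (clamp b) (clamp \o x))
  \oo (nbhs a)) => //.
by apply: continuous_joe_param => i; apply: clamp_itv.
Unshelve. all: by end_near. Qed.

(** Every value in [0, 1] is attained by kappa, with a nonincreasing choice of
    parameters: the largest a at which kappa is at least r.  No monotonicity of
    kappa in the parameter is needed. *)
Lemma joe_parameter : exists alpha : R -> R, [/\
  forall r, 0 <= r <= 1 -> 0 <= alpha r <= 1,
  forall r s, 0 <= r -> r <= s -> s <= 1 -> alpha s <= alpha r &
  forall r, 0 <= r <= 1 -> forall (dp : measure_display) (O : measurableType dp)
      (Pr : probability O R) (X Y : {RV Pr >-> R}),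
    joe_pair_law (alpha r) X Y -> kappa X Y = r].
Proof.
have [P PL] := joe_pair_law_exists.
pose K (a : R) := kappa (coord (P a) 0) (coord (P a) 1).
have cK : continuous K by exact: continuous_kappa_joe.
have KE a (dp : measure_display) (O : measurableType dp)
    (Pr : probability O R) (X Y : {RV Pr >-> R}) : 0 <= a <= 1 ->
    joe_pair_law a X Y -> kappa X Y = K a.
  by move=> a01 L; apply: (kappa_joe_pair_law L); have := PL a; rewrite clamp_id.
have K0 : K 0 = 1.
  by apply: kappa_joe0; have := PL 0; rewrite clamp_id // lexx ler01.
have K1 : K 1 = 0.
  by apply: kappa_joe1; have := PL 1; rewrite clamp_id // lexx ler01.
pose S r := [set a | 0 <= a <= 1 /\ r <= K a].
have S0 r : 0 <= r <= 1 -> S r 0.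
  by move=> /andP[_ r1]; split; rewrite ?K0 // lexx ler01.
have Sub r : ubound (S r) 1 by move=> a [/andP[]].
have Ssup r : 0 <= r <= 1 -> has_sup (S r).
  by move=> r01; split; [exists 0; exact: S0|exists 1].
have A01 r : 0 <= r <= 1 -> 0 <= sup (S r) <= 1.
  move=> r01; apply/andP; split.
    by apply: ub_le_sup; [exists 1|exact: S0].
  by apply: ge_sup; [exists 0; exact: S0|].
exists (fun r => sup (S r)); split=> // [r s r0 rs s1|r r01].
  have s01 : 0 <= s <= 1 by rewrite s1 (le_trans r0).
  apply: ge_sup; first by exists 0; exact: S0.
  move=> a [a01 sa]; apply: ub_le_sup; first by exists 1.
  by split=> //; apply: le_trans sa.
move=> dp O Pr X Y L; rewrite (KE _ _ _ _ _ _ (A01 r r01) L) {L}.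
set a := sup (S r); have /andP[a0 a1] := A01 r r01; rewrite -/a in a0 a1.
have [/andP[r0 r1]] := r01.
apply/eqP; rewrite eq_le; apply/andP; split; rewrite leNgt; apply/negP => H.
  have e0 : 0 < K a - r by rewrite subr_gt0.
  have /cvgrPdist_lt /(_ _ e0) /nbhs_ballP[d /= d0 aK] := cK a.
  have a_lt1 : a < 1.
    by rewrite lt_neqAle a1 andbT; apply: contraTneq H => ->; rewrite K1 -leNgt.
  pose b := Num.min (a + d / 2) 1.
  have ab : a < b by rewrite lt_min a_lt1 andbT ltrDl divr_gt0.
  have bd : b - a < d.
    have : b <= a + d / 2 by rewrite ge_min lexx.
    lra.
  suff : b <= a by rewrite leNgt ab.
  apply: ub_le_sup; first by exists 1.
  split; first by rewrite (le_trans a0 (ltW ab)) ge_min lexx orbT.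
  have : `|K a - K b| < K a - r.
    by apply: aK; rewrite /ball /= ltr0_norm ?subr_lt0 // opprB.
  by move=> /(le_lt_trans (ler_norm _)); rewrite ltrD2l ltrN2 => /ltW.
have e0 : 0 < r - K a by rewrite subr_gt0.
have /cvgrPdist_lt /(_ _ e0) /nbhs_ballP[d /= d0 aK] := cK a.
have [b [b01 rb] ab] := sup_adherent d0 (Ssup r r01); rewrite -/a in ab.
have ba : b <= a by apply: ub_le_sup; [exists 1|].
have : `|K a - K b| < r - K a.
  by apply: aK; rewrite /ball /= ger0_norm ?subr_ge0 // ltrBlDl -ltrBlDr.
rewrite distrC => /(le_lt_trans (ler_norm _)).
by rewrite ltrD2r ltNge rb.
Qed.

End Concordance.

(** * Rooted trees *)

Section Trees.
Variable T : rooted_tree.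
Implicit Types (v w x y c : T) (k : nat).

Lemma on_root_pathP w x :
  reflect (exists k, iter k (@parent T) w = x) (on_root_path w x).
Proof.
apply: (iffP idP) => [H|[k <-]]; last exact: fconnect_iter.
by exists (findex (@parent T) w x); rewrite iter_findex.
Qed.

Lemma on_root_path_trans w x y :
  on_root_path w x -> on_root_path x y -> on_root_path w y.
Proof. exact: connect_trans. Qed.

Lemma on_root_path_parent v w : is_parent v w -> on_root_path w v.
Proof. by case/andP=> _ /eqP <-; exact: fconnect1. Qed.

Lemma iter_depth v : iter (depth v) (@parent T) v = root T.
Proof. by rewrite /depth iter_findex //; exact: connected_root. Qed.

Lemma depth_min k v : iter k (@parent T) v = root T -> (depth v <= k)%N.
Proof.
move=> E; have [kv|kv] := ltnP k (fingraph.order (@parent T) v).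
  by rewrite /depth -E findex_iter.
by apply: leq_trans kv; apply: ltnW; apply: findex_max; exact: connected_root.
Qed.

Lemma depth_lt v : (depth v < #|T|)%N.
Proof.
apply: (@leq_trans (fingraph.order (@parent T) v)); last exact: max_card.
by apply: findex_max; exact: connected_root.
Qed.

Lemma depth0 v : depth v = 0%N -> v = root T.
Proof. by move=> v0; rewrite -[LHS]/(iter 0 (@parent T) v) -v0 iter_depth. Qed.

Lemma depth_parent v : depth (parent v) = (depth v).-1.
Proof.
case E : (depth v) => [|k] /=.
  by rewrite (depth0 E) parent_root -(depth0 E) E.
apply/eqP; rewrite eqn_leq depth_min /=; last by rewrite -iterSr -E iter_depth.
by rewrite -ltnS -E depth_min // iterSr iter_depth.
Qed.

Lemma depth_child v w : is_parent v w -> depth w = (depth v).+1.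
Proof.
case/andP=> w_root /eqP <-; rewrite depth_parent prednK // lt0n.
by apply: contra w_root => /eqP /depth0 ->.
Qed.

Lemma depth_iter k v : depth (iter k (@parent T) v) = (depth v - k)%N.
Proof. by elim: k => [|k IH]; rewrite ?subn0 // iterS depth_parent IH subnS. Qed.

Lemma on_root_path_depth x w :
  on_root_path w x -> (depth w <= depth x)%N -> w = x.
Proof.
case/on_root_pathP=> k <-; rewrite depth_iter.
case: k => [//|k]; case E : (depth w) => [|m]; last by rewrite leqNgt ltn_subrL.
by move=> _; rewrite (depth0 E); elim: k.+1 => //= ? <-; rewrite parent_root.
Qed.

Lemma on_root_path_total w x y : on_root_path w x -> on_root_path w y ->
  (depth x <= depth y)%N -> on_root_path y x.
Proof.
case/on_root_pathP=> k xE /on_root_pathP[l yE] xy.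
have [lk|/ltnW kl] := leqP l k.
  by apply/on_root_pathP; exists (k - l)%N; rewrite -yE -iterD subnK.
have yx : on_root_path x y.
  by apply/on_root_pathP; exists (l - k)%N; rewrite -xE -iterD subnK.
by rewrite (on_root_path_depth yx xy); exact: connect0.
Qed.

Lemma on_root_path_child w x : on_root_path w x ->
  w = x \/ exists2 c, is_parent x c & on_root_path w c.
Proof.
case/on_root_pathP=> k; elim: k => [|k IH] /= E; first by left.
have [r|nr] := eqVneq (iter k (@parent T) w) (root T).
  by apply: IH; rewrite r -E r parent_root.
right; exists (iter k (@parent T) w); first by rewrite /is_parent nr E eqxx.
by apply/on_root_pathP; exists k.
Qed.

Lemma child_uniq v c c' w : is_parent v c -> is_parent v c' ->
  on_root_path w c -> on_root_path w c' -> c = c'.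
Proof.
move=> vc vc' wc wc'.
have E : depth c = depth c' by rewrite (depth_child vc) (depth_child vc').
by apply/esym; apply: on_root_path_depth; rewrite -?E //;
  apply: (on_root_path_total wc wc'); rewrite E.
Qed.

Lemma leaf_path v w : leaf v -> on_root_path w v -> w = v.
Proof.
move=> /eqP v_leaf /on_root_path_child[//|[c vc _]].
by have := finset.in_set0 c; rewrite -v_leaf inE vc.
Qed.

(** A common ancestor none of whose children is a common ancestor is the
    lowest. *)
Lemma lca_eq v w w' : on_root_path w v -> on_root_path w' v ->
  (forall c, is_parent v c -> on_root_path w c -> on_root_path w' c -> False) ->
  lca w w' = v.
Proof.
move=> wv w'v vmax; rewrite /lca.
case: arg_maxnP => [|x /andP[wx w'x] xmax].
  by rewrite /on_root_path !connected_root.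
have vx : (depth v <= depth x)%N by apply: xmax; rewrite wv w'v.
have /on_root_path_child[//|[c vc xc]] := on_root_path_total wv wx vx.
by case: (vmax c vc); [exact: on_root_path_trans xc|exact: on_root_path_trans xc].
Qed.

(** Induction from the leaves to the root *)
Lemma tree_ind (Q : T -> Prop) :
  (forall v, (forall w, is_parent v w -> Q w) -> Q v) -> forall v, Q v.
Proof.
move=> step v; have [n] := ubnP (#|T| - depth v); elim: n v => // n IH v vn.
apply: step => w vw; apply: IH; have := depth_lt v; rewrite (depth_child vw); lia.
Qed.

End Trees.

(** * Nested Joe copulas *)

Section NestedJoe.
Context {R : realType} {d : nat} (T : hierarchical_tree R d) (a : T -> R).
Implicit Types (v w c : T) (i j : 'I_d) (u : 'I_d -> R).

(** The nested expression on the subtree of v. The recursion is on a bound n on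
    the height of the subtree; #|T| - k exceeds the height of a node at
    depth k. *)
Fixpoint nested_joe_rec n v u : R :=
  if n is n'.+1 then
    if leaf v then joe (a v) (fun k : 'I_#|group v| => u (enum_val k))
    else joe (a v)
      (fun k : 'I_#|children v| => nested_joe_rec n' (enum_val k) u)
  else 1.

Definition nested_joe v u : R := nested_joe_rec (#|T| - depth v) v u.

Lemma nested_joe_leaf v u : leaf v ->
  nested_joe v u = joe (a v) (fun k : 'I_#|group v| => u (enum_val k)).
Proof.
move=> vl; rewrite /nested_joe; have := depth_lt v; rewrite -subn_gt0.
by case: (_ - _)%N => // n _; rewrite /= vl.
Qed.

Lemma nested_joe_node v u : ~~ leaf v ->
  nested_joe v u =
    joe (a v) (fun k : 'I_#|children v| => nested_joe (enum_val k) u).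
Proof.
move=> vl; rewrite {1}/nested_joe; have := depth_lt v; rewrite -subn_gt0.
case E : (_ - _)%N => [//|n] _; rewrite /= (negbTE vl).
congr joe; apply/funext => k; rewrite /nested_joe; congr nested_joe_rec.
have := enum_valP k; rewrite inE => /depth_child ->; lia.
Qed.

Lemma leaf_leaf_of i : leaf (leaf_of T i).
Proof. by rewrite -leaf_ofP codom_f. Qed.

(** The group of some leaf of the subtree of v contains i. *)
Definition below v i : bool := on_root_path (leaf_of T i) v.

Lemma below_leaf v i : leaf v -> below v i = (i \in group v).
Proof.
move=> vl; rewrite inE; apply/idP/eqP => [/(leaf_path vl) //|<-].
exact: connect0.
Qed.

Lemma below_node v i : ~~ leaf v -> below v i ->
  exists2 c, c \in children v & below c i.
Proof.
move=> vl /on_root_path_child[E|[c vc ci]].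
  by rewrite -E leaf_leaf_of in vl.
by exists c; rewrite // inE.
Qed.

Lemma below_child v c i : c \in children v -> below c i -> below v i.
Proof.
by rewrite inE => vc ci; apply: on_root_path_trans ci (on_root_path_parent vc).
Qed.

Lemma nested_joe_const1 v u :
  (forall i, below v i -> u i = 1) -> nested_joe v u = 1.
Proof.
elim/tree_ind: v => v IH u1; case: (boolP (leaf v)) => vl.
  rewrite nested_joe_leaf // joe_const1 // => k; apply: u1.
  by rewrite below_leaf // enum_valP.
rewrite nested_joe_node // joe_const1 // => k.
have vk := enum_valP k; apply: IH => [|i ki]; first by rewrite inE in vk.
by apply: u1; apply: below_child ki.
Qed.

Lemma enum_val_exists (X : finType) (A : {set X}) x :
  x \in A -> exists k : 'I_#|A|, enum_val k = x.
Proof. by move=> xA; exists (enum_rank_in xA x); rewrite enum_rankK_in. Qed.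

Lemma nested_joe_single v u i : below v i -> u i <= 1 ->
  (forall j, below v j -> j != i -> u j = 1) -> nested_joe v u = u i.
Proof.
move=> + ui; elim/tree_ind: v => v IH vi u1; case: (boolP (leaf v)) => vl.
  rewrite below_leaf // in vi; rewrite nested_joe_leaf //.
  have [k ki] := enum_val_exists vi.
  rewrite (@joe_single _ _ _ _ k) /= ?ki // => l lk; apply: u1.
    by rewrite below_leaf // enum_valP.
  by rewrite -ki (inj_eq enum_val_inj).
have [c vc ci] := below_node vl vi; have [k kc] := enum_val_exists vc.
rewrite inE in vc; have cE : nested_joe c u = u i.
  apply: IH => // j cj; apply: u1; rewrite -kc in cj.
  exact: below_child (enum_valP k) cj.
rewrite nested_joe_node // (@joe_single _ _ _ _ k) /= ?kc ?cE // => l lk.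
have vl' := enum_valP l; apply: nested_joe_const1 => j lj; apply: u1.
  exact: below_child vl' lj.
apply: contra_neq lk => ji; rewrite ji in lj; rewrite inE in vl'.
by apply: enum_val_inj; rewrite kc; exact: (child_uniq vl' vc lj ci).
Qed.

Hypothesis a01 : forall v, 0 <= a v <= 1.

Lemma nested_joe_pair v u i j :
  i != j -> below v i -> below v j -> unit_cube u ->
  (forall k, below v k -> k != i -> k != j -> u k = 1) ->
  nested_joe v u = joe (a (lca (leaf_of T i) (leaf_of T j))) (vec2 (u i) (u j)).
Proof.
move=> ij + + cu; elim/tree_ind: v => v IH vi vj u1.
case: (boolP (leaf v)) => vl.
  have -> : lca (leaf_of T i) (leaf_of T j) = v.
    apply: lca_eq => // c vc; have := finset.in_set0 c.
    by rewrite -(eqP vl) inE vc.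
  rewrite below_leaf // in vi; rewrite below_leaf // in vj.
  have [k ki] := enum_val_exists vi; have [l lj] := enum_val_exists vj.
  rewrite nested_joe_leaf // (@joe_pair _ _ _ _ k l) /= ?ki ?lj //.
    by rewrite -(inj_eq enum_val_inj) ki lj.
  move=> m mk ml; apply: u1; first by rewrite below_leaf // enum_valP.
    by rewrite -ki (inj_eq enum_val_inj).
  by rewrite -lj (inj_eq enum_val_inj).
have [c vc ci] := below_node vl vi; have [c' vc' cj] := below_node vl vj.
have [k kc] := enum_val_exists vc; have [k' kc'] := enum_val_exists vc'.
have pc : is_parent v c by rewrite inE in vc.
have pc' : is_parent v c' by rewrite inE in vc'.
have other (m n : 'I_#|children v|) p :
    below (enum_val m) p -> below (enum_val n) p -> m = n.
  move=> mp np; have := enum_valP m; have := enum_valP n; rewrite !inE => vn vm.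
  by apply: enum_val_inj; exact: (child_uniq vm vn mp np).
rewrite nested_joe_node //; have [cc'|cc'] := eqVneq c c'.
  rewrite -cc' in cj.
  have cE : nested_joe c u =
      joe (a (lca (leaf_of T i) (leaf_of T j))) (vec2 (u i) (u j)).
    by apply: IH => // m cm; apply: u1; apply: below_child cm.
  rewrite (@joe_single _ _ _ _ k) /= ?kc ?cE //.
    have /andP[a0 _] := a01 (lca (leaf_of T i) (leaf_of T j)).
    suff cu2 : unit_cube (vec2 (u i) (u j)) by case/andP: (joe_itv a0 cu2).
    by move=> m; rewrite /vec2; case: ifP.
  move=> m mk; apply: nested_joe_const1 => l ml; apply: u1.
  - exact: below_child (enum_valP m) ml.
  - by apply: contra_neq mk => li; apply: other ml _; rewrite kc li.
  - by apply: contra_neq mk => lj; apply: other ml _; rewrite kc lj.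
have -> : lca (leaf_of T i) (leaf_of T j) = v.
  apply: lca_eq => // b vb bi bj.
  by rewrite -(child_uniq vb pc bi ci) -(child_uniq vb pc' bj cj) eqxx in cc'.
have one l : u l <= 1 by case/andP: (cu l).
have cE : nested_joe c u = u i.
  apply: nested_joe_single => // l cl li; apply: u1 => //.
    exact: below_child cl.
  apply: contra_neq cc' => lj; rewrite lj in cl.
  exact: (child_uniq pc pc' cl cj).
have cE' : nested_joe c' u = u j.
  apply: nested_joe_single => // l cl lj; apply: u1 => //.
    exact: below_child cl.
  apply: contra_neq cc' => li; rewrite li in cl.
  exact: (child_uniq pc pc' ci cl).
rewrite (@joe_pair _ _ _ _ k k') /= ?kc ?kc' ?cE ?cE' //.
  by apply: contra_neq cc' => kk'; rewrite -kc -kc' kk'.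
move=> m mk mk'; apply: nested_joe_const1 => l ml; apply: u1.
- exact: below_child (enum_valP m) ml.
- by apply: contra_neq mk => li; apply: other ml _; rewrite kc li.
- by apply: contra_neq mk' => lj; apply: other ml _; rewrite kc' lj.
Qed.

Hypothesis a_anti : forall v w, is_parent v w -> a w <= a v.

Lemma nestable_nested_joe v : joe_nestable (a v) (nested_joe v).
Proof.
elim/tree_ind: v => v IH; case: (boolP (leaf v)) => vl.
  rewrite (_ : nested_joe v =
    fun u => joe (a v) (fun k : 'I_#|group v| => u (enum_val k))).
    apply: (joe_nestable_joe
      (F := fun (k : 'I_#|group v|) u => u (enum_val k))) => // k.
    by exists 0; [rewrite lexx; case/andP: (a01 v)|exact: joe_nestable_var].
  by apply/funext => u; exact: nested_joe_leaf.
rewrite (_ : nested_joe v =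
  fun u => joe (a v) (fun k : 'I_#|children v| => nested_joe (enum_val k) u)).
  apply: (joe_nestable_joe
    (F := fun (k : 'I_#|children v|) u => nested_joe (enum_val k) u)) => // k.
  have := enum_valP k; rewrite inE => vk; exists (a (enum_val k)); last exact: IH.
  by rewrite a_anti // andbT; case/andP: (a01 (enum_val k)).
by apply/funext => u; exact: nested_joe_node.
Qed.

Lemma below_root i : below (root T) i.
Proof. exact: connected_root. Qed.

Lemma cube_cdf_nested_joe : cube_cdf (nested_joe (root T)).
Proof.
exact: (cube_cdf_of_nestable (a01 (root T)) (nestable_nested_joe (root T))).
Qed.

Lemma nested_archimedean_nested_joe : is_copula (nested_joe (root T)) ->
  nested_archimedean_copula T (nested_joe (root T)).
Proof.
move=> HC; split=> //; exists nested_joe; split=> // v vl.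
  exists (@joe R (a v) #|group v|); first exact: archimedean_joe.
  by move=> u; exact: nested_joe_leaf.
exists (@joe R (a v) #|children v|); first exact: archimedean_joe.
by move=> u; exact: nested_joe_node.
Qed.

End NestedJoe.

(** * Concordance matrices of nested Joe copulas *)

Section PairMargins.
Context {R : realType}.

(** Bivariate margins are obtained by setting the other arguments to 1. *)
Lemma joint_cdf_pair {dp : measure_display} {O : measurableType dp}
    {Pr : probability O R} n (X : 'I_n -> {RV Pr >-> R}) (i j : 'I_n)
    (u : 'I_2 -> R) :
  (forall k, uniform_margin (X k)) -> i != j -> unit_cube u ->
  joint_cdf (rv_pair (X i) (X j)) u =
  joint_cdf X (fun k => if k == i then u 0 else if k == j then u 1 else 1).
Proof.
move=> UX ij cu; have [mG G1] := uniform_margin_range UX.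
set x := fun k => _.
have m1 := @measurable_le R 2 _ _ (fun k => rv_pair (X i) (X j) k) u
  (fun k => measurable_funPT _).
have m2 := @measurable_le R n _ _ (fun k => X k) x (fun k => measurable_funPT _).
rewrite /joint_cdf -(probability_setI1 m1 mG G1) -(probability_setI1 m2 mG G1).
congr (Pr _); apply/seteqP; split=> w /= [H Gw]; split=> // k.
  rewrite /x; case: eqP => [->|_]; first exact: (H 0).
  by case: eqP => [->|_]; [exact: (H 1)|case/andP: (Gw k)].
case: (ord2P k) => ->; first by have := H i; rewrite /x eqxx.
by have := H j; rewrite /x eqxx eq_sym (negbTE ij).
Qed.

Lemma joe_pair_law_diag {dp : measure_display} {O : measurableType dp}
    {Pr : probability O R} (X : {RV Pr >-> R}) :
  uniform_margin X -> joe_pair_law 0 X X.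
Proof.
move=> UX; split=> // u cu; rewrite /joe eqxx /comonotone_copula.
have c01 := comonotone_itv cu.
rewrite -(UX _ c01) cdfE; congr (Pr _); apply/seteqP; split=> w /= H.
  apply/bigmin_geP; split=> [|k _].
    by apply: le_trans (H 0) _; case/andP: (cu 0).
  by case: (ord2P k) => ->; [exact: (H 0)|exact: (H 1)].
by move=> k; case: (ord2P k) => ->; have /bigmin_geP[_ Hk] := H;
  [exact: (Hk 0)|exact: (Hk 1)].
Qed.

End PairMargins.

Theorem proposition9 (R : realType) (kappa : concordance_map R)
  (kappaP : measure_of_concordance kappa) (d : nat)
  (T : hierarchical_tree R d) (P : 'M[R]_d)
  (PT : P = hierarchical_matrix T)
  (rho_root : 0 <= rho (root T))
  (rho_mono : forall v v' : T, is_parent v v' -> 0 <= rho v <= rho v') :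
  kappa_compatible kappa P /\
  exists C : ('I_d -> R) -> R,
    nested_archimedean_copula T C /\ kappa_attainable_by kappa P C.
Proof.
have [alpha [alpha01 alpha_anti kappa_alpha]] := joe_parameter kappaP.
have rho01 (v : T) : 0 <= rho v <= 1.
  have /andP[_ ->] := rho_itv v; rewrite andbT.
  have [->//|v_root] := eqVneq v (root T).
  have : is_parent (parent v) v by rewrite /is_parent v_root eqxx.
  by move=> /rho_mono /andP[]; exact: le_trans.
pose a (v : T) := alpha (rho v).
have a01 (v : T) : 0 <= a v <= 1 by exact: alpha01.
have a_anti (v w : T) : is_parent v w -> a w <= a v.
  move=> /rho_mono /andP[v0 vw]; apply: alpha_anti => //.
  by case/andP: (rho01 w).
pose C := nested_joe a (root T).
have one01 : 0 <= (1 : R) <= 1 by rewrite ler01 lexx.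
have [|Q [UQ QC copC]] := cube_cdf_copula (cube_cdf_nested_joe a01 a_anti).
  move=> u i cu u1; apply: nested_joe_single => [||j _ ji].
  - exact: below_root.
  - by case/andP: (cu i).
  - exact: u1.
suff attain : kappa_attainable_by kappa P C.
  split; last first.
    exists C; split=> //; apply: nested_archimedean_nested_joe => //.
    by case: copC.
  have [dp [S [Pr [X [cX _ PX]]]]] := attain.
  by exists dp, S, Pr, X.
do 2 eexists; exists Q, (coord Q); split=> // [i|].
  exact: continuous_uniform_margin.
rewrite PT; apply/matrixP => i j; rewrite !mxE; case: eqVneq => [<-|ij].
  by rewrite (kappa_joe0 kappaP) //; exact: joe_pair_law_diag.
apply/esym; apply: kappa_alpha; first exact: rho01.
split=> // u cu; rewrite joint_cdf_pair //.
set x := fun k => _.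
have cx : unit_cube x.
  by move=> k; rewrite /x; case: ifP => // _; case: ifP.
have x1 k : below (root T) k -> k != i -> k != j -> x k = 1.
  by move=> _ /negbTE ki /negbTE kj; rewrite /x ki kj.
have vec2x : vec2 (x i) (x j) = u.
  have ji : (j == i) = false by rewrite eq_sym (negbTE ij).
  apply/funext => k; rewrite /vec2 /x !eqxx ji.
  by case: (ord2P k) => ->.
have := nested_joe_pair a01 ij (below_root T i) (below_root T j) cx x1.
by rewrite vec2x QC // => ->.
Qed.
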